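(* Let $b \in (0,1)$, $a\in[-b,b]$ and $s\in[0,1]$, and let $\{S_n\}$ be the elephant random walk with stops with parameters $(a,b,s)$ and $\Sigma_n$ its number of moves up to time $n$. If $a=0$ or $s=1/2$, then $\rho[S_n,\Sigma_n]=0$ for all $n\in\mathbb{N}$. If $a\neq 0$ and $s\neq 1/2$, then as $n\to\infty$, \[ \rho[S_n,\Sigma_n]\sim \begin{cases} (2s-1)\cdot P_{a,b}\, n^{-(b-2a)/2} & \text{if } a\in[-b,b/2),\\ (2s-1)\cdot Q_a\,(\log n)^{-1/2} & \text{if } a=b/2,\\ (2s-1)\cdot R_{a,b,s} & \text{if } a\in(b/2,b], \end{cases} \] where \[ P_{a,b}=\frac{\sqrt{(b-2a)\Gamma(b)}\cdot\{(a+b)\cdot B(a+1,b)-1\}}{\Gamma(a+1)\cdot\sqrt{b\cdot B(b,b)-1}},\qquad Q_a=\frac{\sqrt{\Gamma(2a)}\cdot\{a\cdot B(a,2a)-1\}}{\Gamma(a+1)\cdot\sqrt{2a\cdot B(2a,2a)-1}}, \] \[ R_{a,b,s}=\frac{\sqrt{2a-b}\cdot\{a\cdot B(a,b)-1\}}{\sqrt{\{a^2\cdot B(a,a)-(2s-1)^2\cdot(2a-b)\}\{b\cdot B(b,b)-1\}}}. \] Moreover $P_{a,b}$ is positive for $a\in(0,b/2)$ and negative for $a\in[-b,0)$, while $Q_a$ (for $a=b/2$) and $R_{a,b,s}$ (for $a\in(b/2,b]$) are positive.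
   Context: Elephant random walk with stops (ERWS): let $s\in[0,1]$, and let $p,q\in[0,1]$, $r\in[0,1)$ satisfy $p+q+r=1$. Put $a:=p-q$ and $b:=1-r$, so $b\in(0,1]$ and $a\in[-b,b]$ (equivalently $p=(b+a)/2$, $q=(b-a)/2$, $r=1-b$). The first step $X_1$ equals $+1$ with probability $s$ and $-1$ with probability $1-s$. For each $n\in\mathbb{N}=\{1,2,\ldots\}$, let $U_n$ be uniformly distributed on $\{1,\ldots,n\}$, and let $X_{n+1}=X_{U_n}$ with probability $p$, $X_{n+1}=-X_{U_n}$ with probability $q$, and $X_{n+1}=0$ with probability $r$; all of these choices (the value of $X_1$, the $U_n$, and the selections among the three alternatives at each step) are made independently. Set $S_0:=0$ and $S_n:=\sum_{i=1}^n X_i$ for $n\in\mathbb{N}$. The number of moves up to time $n$ is $\Sigma_0:=0$, $\Sigma_n:=\sum_{i=1}^n 1_{\{X_i\neq 0\}}=\sum_{i=1}^n X_i^2$. $\rho[X,Y]$ denotes the correlation coefficient of $X$ and $Y$, with the convention $\rho[X,Y]=0$ if $X$ or $Y$ has zero variance. $\Gamma$ is the gamma function and $B(x,y):=\int_0^1 u^{x-1}(1-u)^{y-1}\,du$ for $x,y>0$ is the beta function. $f(n)\sim g(n)$ means $f(n)/g(n)\to1$. *)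

(* Defs.v *)
From HB Require Import structures.
From mathcomp Require Import all_boot all_order all_algebra finmap.
From mathcomp Require Import all_classical all_reals all_analysis.

Set Implicit Arguments.
Unset Strict Implicit.
Unset Printing Implicit Defensive.

Import Order.TTheory GRing.Theory Num.Theory.
Import numFieldNormedType.Exports.

Local Open Scope classical_set_scope.
Local Open Scope ring_scope.

Section Probability.
Context (R : realType) (d : measure_display) (T : measurableType d).
Variable P : probability T R.

(** Mutual independence of a family of set systems: the product rule over
    every finite subfamily. *)
Definition mutually_independent (I : choiceType) (F : I -> set (set T)) : Prop :=
  forall (J : {fset I}) (E : I -> set T),
    (forall i, i \in J -> F i (E i)) ->
    P (\bigcap_(i in [set` J]) E i) = (\prod_(i <- J) P (E i))%E.

(** The variances below are finite for the (almost surely bounded) variables considered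
    here, so that [fine] loses nothing. *)
Definition correlation (X Y : T -> R) : R :=
  if ('V_P[X] == 0%E) || ('V_P[Y] == 0%E) then 0
  else fine (covariance P X Y) /
       (Num.sqrt (fine 'V_P[X]) * Num.sqrt (fine 'V_P[Y])).

(** [X1] is the first step, [U n] (n >= 1) the remembered time and [xi n]
    (n >= 1) the selection made for step n + 1, with values 1 (repeat the
    remembered step), -1 (reverse it), 0 (stop).  The sigma-algebras that they
    generate are indexed by [option (nat + nat)]; there is a shift by one since
    [U 0] and [xi 0] play no role. *)
Definition erws_sigma (X1 : {RV P >-> R}) (U : nat -> {RV P >-> nat})
    (xi : nat -> {RV P >-> R}) (i : option (nat + nat)) : set (set T) :=
  match i with
  | None => g_sigma_algebra_preimage X1
  | Some (inl n) => g_sigma_algebra_preimage (U n.+1)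
  | Some (inr n) => g_sigma_algebra_preimage (xi n.+1)
  end.

(** [X 1, X 2, ...] are the steps of an elephant random walk with stops with
    parameters (a, b, s), that is p = (b + a) / 2, q = (b - a) / 2 and
    r = 1 - b; [X 0] is unconstrained and never used. *)
Definition is_erws (a b s : R) (X : nat -> {RV P >-> R}) : Prop :=
  exists (U : nat -> {RV P >-> nat}) (xi : nat -> {RV P >-> R}),
    [/\ P (X 1%N @^-1` [set 1]) = s%:E /\
        P (X 1%N @^-1` [set -1]) = (1 - s)%:E,
        forall n k, (1 <= k <= n)%N -> P (U n @^-1` [set k]) = (n%:R^-1)%:E,
        forall n, (1 <= n)%N ->
          [/\ P (xi n @^-1` [set 1]) = ((b + a) / 2)%:E,
              P (xi n @^-1` [set -1]) = ((b - a) / 2)%:E &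
              P (xi n @^-1` [set 0]) = (1 - b)%:E],
        mutually_independent (erws_sigma (X 1%N) U xi) &
        forall n, (1 <= n)%N ->
          {ae P, forall w, X n.+1 w = xi n w * X (U n w) w}].

Definition position (X : nat -> {RV P >-> R}) (n : nat) (w : T) : R :=
  \sum_(1 <= i < n.+1) X i w.

Definition moves (X : nat -> {RV P >-> R}) (n : nat) (w : T) : R :=
  \sum_(1 <= i < n.+1) (X i w != 0)%:R.

End Probability.

Section Constants.
Context (R : realType).

(** Meaningful for 0 < x. *)
Definition Gamma (x : R) : R :=
  \int[lebesgue_measure]_(t in `]0, +oo[) (t `^ (x - 1) * expR (- t)).

(** Meaningful for 0 < x and 0 < y.  The library's [beta_fun] only takes
    arguments in [nat]. *)
Definition Beta (x y : R) : R :=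
  \int[lebesgue_measure]_(u in `]0, 1[) (u `^ (x - 1) * (1 - u) `^ (y - 1)).

Definition Pconst (a b : R) : R :=
  Num.sqrt ((b - 2 * a) * Gamma b) * ((a + b) * Beta (a + 1) b - 1) /
  (Gamma (a + 1) * Num.sqrt (b * Beta b b - 1)).

Definition Qconst (a : R) : R :=
  Num.sqrt (Gamma (2 * a)) * (a * Beta a (2 * a) - 1) /
  (Gamma (a + 1) * Num.sqrt (2 * a * Beta (2 * a) (2 * a) - 1)).

Definition Rconst (a b s : R) : R :=
  Num.sqrt (2 * a - b) * (a * Beta a b - 1) /
  Num.sqrt ((a ^+ 2 * Beta a a - (2 * s - 1) ^+ 2 * (2 * a - b)) *
            (b * Beta b b - 1)).

Definition asymptotic (f g : nat -> R) : Prop :=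
  f n / g n @[n --> \oo] --> (1 : R).

End Constants.

(* Main.v *)
Require Import Defs.
From HB Require Import structures.
From mathcomp Require Import all_boot all_order all_algebra finmap.
From mathcomp Require Import all_classical all_reals all_analysis.
From mathcomp Require Import measurable_realfun.
From mathcomp Require Import ring lra.

Set Implicit Arguments.
Unset Strict Implicit.
Unset Printing Implicit Defensive.

Import Order.TTheory GRing.Theory Num.Theory.
Import numFieldNormedType.Exports.

Local Open Scope classical_set_scope.
Local Open Scope ring_scope.

(** Write [A c n] for the product of the [1 + c / k] with [1 <= k < n]
    ([rising c n]), which grows like [n `^ c / Gamma (c + 1)].

    The remembered step is uniform among the past ones, so given the past the
    next step [x] satisfies [E x = E x ^ 3 = a S_n / n] and
    [E x ^ 2 = b Sigma_n / n].  Hence the first two moments of the position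
    [S_n] and of the number of moves [Sigma_n] obey linear recursions, and these
    have closed solutions in terms of [A]: with
    [[
      f a b n = (a + b) / b * A (a + b) n - a / b * A a n - A a n * A b n
    ]]
    ([cov_moves]) the covariance is [(2 s - 1) f a b n], and the variance of
    [Sigma_n] is [f b b n]; the second moment of [S_n] is a combination of [A b]
    and [A (2 a)], with a harmonic sum instead in the critical case [b = 2 a].
    The covariance vanishes identically when [a = 0] or [s = 1 / 2], and
    otherwise the theorem reads off the growth of the three quantities.

    Probability ([rep_steps], [correlation_erws]).  A function of the first steps
    is almost surely a finite combination of indicators of events of the form
    (first step, remembered times, selections), whose probabilities factor by
    independence.  Its expectation is therefore the finite iterated average
    [walkE], and the moment recursions become identities between finite sums.

    Analysis ([cvg_Beta_Gamma], [cvg_rising], [cvg_rising_ratio]).  Integration by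
    parts gives the recursions of the Beta function in each argument, and
    dominated convergence gives Euler's limit of [n ^ x B(x, y + n)], which is
    [Gamma x].  Since [1 / A c n = (n + c) B(c + 1, n)], this yields the growth of
    [A c n] and the limit [(a + b) B(a + 1, b)] of
    [(a + b) / b * A (a + b) n / (A a n * A b n)].

    Signs ([Beta_product_gt1], [Beta_product_lt1]).  The number
    [(a + b) B(a + 1, b)] is the infinite product over [k >= 0] of
    [(a + b + k) (1 + k) / ((a + 1 + k) (b + k))]; numerator minus denominator is
    [a (1 - b)], so every factor lies on the same side of 1, namely the one given
    by the sign of [a]. *)

(** * Limits of real sequences *)

Section ElementaryLimits.
Context {R : realType}.

Lemma cvg_near_eq (u v : nat -> R) (l : R) :
  (\forall n \near \oo, u n = v n) -> u n @[n --> \oo] --> l ->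
  v n @[n --> \oo] --> l.
Proof. by move=> uv; apply: cvg_trans; exact: near_eq_cvg. Qed.

(** The algebra of limits, restated for applied sequences so that the limits of
    compound expressions are inferred from those of their parts. *)
Lemma cvg_seqM (u v : nat -> R) (l m : R) : u n @[n --> \oo] --> l ->
  v n @[n --> \oo] --> m -> u n * v n @[n --> \oo] --> l * m.
Proof. exact: cvgM. Qed.

Lemma cvg_seqV (u : nat -> R) (l : R) : l != 0 -> u n @[n --> \oo] --> l ->
  (u n)^-1 @[n --> \oo] --> l^-1.
Proof. by move=> l0 ul; exact: cvgV. Qed.

Lemma cvg_seqZ (u : nat -> R) (c l : R) : u n @[n --> \oo] --> l ->
  c * u n @[n --> \oo] --> c * l.
Proof. by apply: cvg_seqM; exact: cvg_cst. Qed.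

Lemma cvg_seqB (u v : nat -> R) (l m : R) : u n @[n --> \oo] --> l ->
  v n @[n --> \oo] --> m -> u n - v n @[n --> \oo] --> l - m.
Proof. exact: cvgB. Qed.

Lemma cvg_seqBc (u : nat -> R) (c l : R) : u n @[n --> \oo] --> l ->
  u n - c @[n --> \oo] --> l - c.
Proof. by move=> ul; apply: cvg_seqB => //; exact: cvg_cst. Qed.

Lemma cvg_seqD (u v : nat -> R) (l m : R) : u n @[n --> \oo] --> l ->
  v n @[n --> \oo] --> m -> u n + v n @[n --> \oo] --> l + m.
Proof. exact: cvgD. Qed.

Lemma cvg_seqcD (u : nat -> R) (c l : R) : u n @[n --> \oo] --> l ->
  c + u n @[n --> \oo] --> c + l.
Proof. by move=> ul; apply: cvg_seqD => //; exact: cvg_cst. Qed.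

Lemma cvg_inv_natD (d : R) : (n%:R + d)^-1 @[n --> \oo] --> (0 : R).
Proof.
apply/gtr0_cvgV0; last first.
  apply/cvgryPge => A; near=> n.
  by rewrite -lerBlDr; near: n; exact: nbhs_infty_ger.
near=> n; rewrite -ltrBlDr sub0r; near: n; exact: nbhs_infty_gtr.
Unshelve. all: by end_near. Qed.

Lemma natD_neq0 (d : R) : \forall n \near \oo, n%:R + d != 0.
Proof.
near=> n; rewrite gt_eqF// -ltrBlDr sub0r; near: n; exact: nbhs_infty_gtr.
Unshelve. all: by end_near. Qed.

Lemma cvg_ratio_natD (c d : R) : (n%:R + c) / (n%:R + d) @[n --> \oo] --> (1 : R).
Proof.
apply: (@cvg_near_eq (fun n => 1 + (c - d) * (n%:R + d)^-1)).
  near=> n.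
  have h : n%:R + d != 0 by near: n; exact: natD_neq0.
  by field.
rewrite -[X in _ --> X]addr0 -(mulr0 (c - d)).
apply: cvgD; first exact: cvg_cst.
by apply: cvgM; [exact: cvg_cst|exact: cvg_inv_natD].
Unshelve. all: by end_near. Qed.

Lemma cvg_powR_natV (c : R) : 0 < c -> n%:R `^ (- c) @[n --> \oo] --> (0 : R).
Proof.
move=> c0; have /cvg_at_rightP h := @powR_cvg0 R c c0.
rewrite -(cvg_shiftS _ _); apply: (@cvg_near_eq (fun n => (n.+1%:R^-1) `^ c)).
  by near=> n; rewrite powRN -powR_inv1 // -powRrM mulN1r powRN.
apply: h; split; first by move=> n; rewrite invr_gt0 ltr0n.
exact: cvg_harmonic.
Unshelve. all: by end_near. Qed.
End ElementaryLimits.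

(** * Exhausting an open interval by compact ones *)

Section Exhaustion.
Context {R : realType}.
Notation mu := (@lebesgue_measure R).

(** The shift by 3 keeps [gap n] below 1 / 2, so that [cpt c n] is a nondegenerate
    interval. *)
Definition gap (n : nat) : R := n.+3%:R^-1.

Definition cpt (c : R) (n : nat) : set R :=
  `[c * gap n, c * (1 - gap n)]%classic.

Lemma gap_bounds n : 0 < gap n < 1 / 2.
Proof.
rewrite /gap invr_gt0 ltr0n/= mul1r ltf_pV2 ?posrE ?ltr0n//.
by rewrite ltr_nat.
Qed.

Lemma sub_cpt c n : 0 < c -> cpt c n `<=` `]0, c[.
Proof.
move=> c0 x; rewrite /cpt /= !in_itv/= => /andP[h1 h2].
have /andP[e0 e1] := gap_bounds n.
by rewrite (lt_le_trans _ h1) ?mulr_gt0// (le_lt_trans h2)// gtr_pMr// ltrBlDr ltrDl.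
Qed.

Lemma cpt_nondecreasing c : 0 < c -> nondecreasing_seq (cpt c).
Proof.
move=> c0; apply/nondecreasing_seqP => n; rewrite subsetEset => x.
rewrite /cpt /= !in_itv/= => /andP[h1 h2].
have h : gap n.+1 <= gap n.
  by rewrite lef_pV2 ?posrE ?ltr0n// ler_nat.
rewrite (le_trans _ h1) ?ler_pM2l// (le_trans h2)// ler_pM2l//.
by rewrite lerD2l lerN2.
Qed.

Lemma bigcup_cpt c : 0 < c -> \bigcup_n cpt c n = `]0, c[%classic.
Proof.
move=> c0; apply/seteqP; split=> [x [n _]|x]; first exact: sub_cpt.
rewrite /= in_itv/= => /andP[x0 xc].
have d0 : 0 < Num.min (x / c) (1 - x / c).
  by rewrite lt_min divr_gt0//= subr_gt0 ltr_pdivrMr// mul1r.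
have [n _ hn] := near_infty_natSinv_lt (PosNum d0).
exists n => //.
have /= := hn n (leqnn _); rewrite lt_min => /andP[h1 h2].
have h : gap n <= n.+1%:R^-1.
  by rewrite lef_pV2 ?posrE ?ltr0n// ler_nat ltnW.
rewrite /cpt/= in_itv/=.
apply/andP; split.
  by rewrite mulrC -ler_pdivlMr// ltW// (le_lt_trans h).
rewrite mulrC -ler_pdivrMr// lerBrDr -lerBrDl ltW// (le_lt_trans h)//.
Qed.

Lemma measurable_cpt c n : measurable (cpt c n).
Proof. exact: measurable_itv. Qed.

(** The Beta kernel is unbounded at both ends of [`]0, 1[], whereas the calculus
    of primitives and of substitutions needs compact intervals; monotone
    convergence bridges the two. *)
Lemma cvg_integral_cpt (c : R) (f : R -> R) : 0 < c ->
  (forall x, 0 < x < c -> 0 <= f x) ->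
  measurable_fun `]0, c[ f ->
  (\int[mu]_(x in cpt c n) (f x)%:E @[n --> \oo] -->
   \int[mu]_(x in `]0%R, c[) (f x)%:E)%E.
Proof.
move=> c0 f0 mf; rewrite -bigcup_cpt//.
apply: ge0_nondecreasing_set_cvg_integral.
- exact: cpt_nondecreasing.
- by move=> i; exact: measurable_cpt.
- move=> i; apply/measurable_EFinP; apply: measurable_funS mf => //.
  exact: sub_cpt.
- by move=> i x /(sub_cpt c0); rewrite /= in_itv/= lee_fin => /f0.
Qed.

Lemma cpt_bounds (c : R) n : 0 < c ->
  c * gap n < c * (1 - gap n).
Proof.
move=> c0; rewrite ltr_pM2l//; have /andP[e0 e1] := gap_bounds n.
lra.
Qed.

Lemma FTC_cpt (F f : R -> R) n :
  (forall x : R, 0 < x < 1 -> is_derive x 1 F (f x)) ->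
  (forall x : R, 0 < x < 1 -> {for x, continuous f}) ->
  (\int[mu]_(x in cpt 1 n) (f x)%:E = (F (1 - gap n) - F (gap n))%:E)%E.
Proof.
move=> dF cf; have /andP[e0 e1] := gap_bounds n.
have hab := @cpt_bounds 1 n ltr01.
rewrite /cpt; rewrite !mul1r in hab *.
have sub (x : R) : gap n <= x <= 1 - gap n -> 0 < x < 1 by lra.
have cF (x : R) : gap n <= x <= 1 - gap n -> {for x, continuous F}.
  move=> /sub/dF h; apply/differentiable_continuous/derivable1_diffP.
  exact: (@ex_derive _ _ _ _ _ _ _ h).
rewrite (@continuous_FTC2 _ f F)//.
- apply: continuous_in_subspaceT => x; rewrite inE/= in_itv/= => /sub.
  exact: cf.
- split.
  + move=> x; rewrite in_itv/= => h.
    apply: (@ex_derive _ _ _ _ _ _ _ (dF x _)); lra.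
  + apply: cvg_at_right_filter; apply: cF; lra.
  + apply: cvg_at_left_filter; apply: cF; lra.
- move=> x; rewrite in_itv/= => h; rewrite derive1E.
  apply: (@derive_val _ _ _ _ _ _ _ (dF x _)); lra.
Qed.

(** A change of variables on each compact interval, passed to the limit. *)
Lemma integral_scale (c : R) (f : R -> R) : 0 < c ->
  (forall x, 0 < x < 1 -> 0 <= f x) ->
  (forall x : R, 0 < x < 1 -> {for x, continuous f}) ->
  measurable_fun setT f ->
  (\int[mu]_(t in `]0%R, c[) (f (t / c))%:E =
   c%:E * \int[mu]_(u in `]0%R, 1%R[) (f u)%:E)%E.
Proof.
move=> c0 f0 cf mf.
have c1 : c != 0 by rewrite gt_eqF.
have hcvg : (\int[mu]_(x in cpt 1 n) (f x)%:E @[n --> \oo] -->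
   \int[mu]_(x in `]0%R, 1%R[) (f x)%:E)%E.
  apply: cvg_integral_cpt => //.
  exact: measurable_funTS.
have hcvg2 : (\int[mu]_(x in cpt c n) (f (x / c))%:E @[n --> \oo] -->
   \int[mu]_(x in `]0%R, c[) (f (x / c))%:E)%E.
  apply: cvg_integral_cpt => //.
    move=> x /andP[x0 xc]; apply: f0; rewrite divr_gt0//=.
    by rewrite ltr_pdivrMr// mul1r.
  apply: measurable_funTS; apply: measurableT_comp => //.
  exact: mulrr_measurable.
apply: (cvg_unique _ hcvg2) => //.
suff -> : (fun n => \int[mu]_(x in cpt c n) (f (x / c))%:E)%E =
    (fun n => c%:E * \int[mu]_(x in cpt 1 n) (f x)%:E)%E by exact: cvgeZl.
apply/funext => n.
have /andP[e0 e1] := gap_bounds n.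
have h1 := @integration_by_substitution_increasing R ( *%R c) (fun t => f (t / c))
  (gap n) (1 - gap n).
have dF (x : R) : is_derive x 1 ( *%R c) c.
  by apply: is_derive_eq; rewrite -[RHS]mulr1; congr (_ * _).
have dFE : derive1 ( *%R c) = cst c.
  by apply/funext => x; rewrite derive1E (@derive_val _ _ _ _ _ _ _ (dF x)).
rewrite /cpt h1.
- rewrite !mul1r dFE -ge0_integralZl//.
  + apply: eq_integral => x _; rewrite /= !fctE.
    by rewrite mulrAC divff// mul1r mulrC.
  + by apply/measurable_EFinP; exact: measurable_funTS.
  + move=> x; rewrite /= in_itv/= lee_fin => h; apply: f0; lra.
  + by rewrite lee_fin ltW.
- lra.
- by move=> x y _ _ xy; rewrite ltr_pM2l.
- by rewrite dFE => x _; exact: cvg_cst.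
- by rewrite dFE; exact: is_cvg_cst.
- by rewrite dFE; exact: is_cvg_cst.
- have cF (x : R) : {for x, continuous ( *%R c)}.
    apply/differentiable_continuous/derivable1_diffP.
    exact: (@ex_derive _ _ _ _ _ _ _ (dF x)).
  split.
  + by move=> x _; exact: (@ex_derive _ _ _ _ _ _ _ (dF x)).
  + by apply: cvg_at_right_filter; exact: cF.
  + by apply: cvg_at_left_filter; exact: cF.
- apply: continuous_in_subspaceT => x; rewrite inE/= in_itv/= => /andP[xl xr].
  suff : {for x, continuous (f \o (fun t => t / c))} by [].
  apply: continuous_comp.
    by apply: cvgM; [exact: cvg_id|exact: cvg_cst].
  apply: cf; apply/andP; split.
    by rewrite divr_gt0// (lt_le_trans _ xl)// mulr_gt0.
  rewrite ltr_pdivrMr// mul1r (le_lt_trans xr)//.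
  by rewrite gtr_pMr// ltrBlDr ltrDl.
Qed.

End Exhaustion.

(** * Recursions of the Beta function *)

Section BetaKernel.
Context {R : realType}.
Implicit Types x y u : R.

Definition beta_kernel x y u := u `^ (x - 1) * (1 - u) `^ (y - 1).

Lemma beta_kernel_ge0 x y u : 0 <= beta_kernel x y u.
Proof. by rewrite mulr_ge0// powR_ge0. Qed.

Lemma continuous_powR x u : 0 < u -> {for u, continuous (fun v : R => v `^ x)}.
Proof.
move=> u0; apply/differentiable_continuous/derivable1_diffP.
exact: (@ex_derive _ _ _ _ _ _ _ (is_derive1_powR x u0)).
Qed.

Lemma is_derive_onem_powR y u : u < 1 ->
  is_derive u 1 (fun v : R => (1 - v) `^ y) (- (y * (1 - u) `^ (y - 1))).
Proof.
move=> u1.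
have d1 : is_derive u 1 (fun v : R => 1 - v) (-1).
  apply: (@is_derive_eq _ _ _ _ _ _ _ _
    (is_deriveB (is_derive_cst (1 : R) u 1) (is_derive_id u 1))).
  by rewrite sub0r.
have d2 : is_derive (1 - u) 1 (fun v : R => v `^ y) (y * (1 - u) `^ (y - 1)).
  by apply: is_derive1_powR; rewrite subr_gt0.
have := @is_derive1_comp R (fun v : R => v `^ y) (fun v : R => 1 - v) u _ _ d2 d1.
by rewrite mulrN1.
Qed.

Lemma is_derive_bump x y u : 0 < u < 1 ->
  is_derive u 1 (fun v : R => v `^ x * (1 - v) `^ y)
    (x * beta_kernel x (y + 1) u - y * beta_kernel (x + 1) y u).
Proof.
move=> /andP[u0 u1].
have d1 := is_derive1_powR x u0.
have d2 := is_derive_onem_powR y u1.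
apply: (@is_derive_eq _ _ _ _ _ _ _ _ (is_deriveM d1 d2)).
rewrite /beta_kernel !addrK /GRing.scale/=; ring.
Qed.

Lemma continuous_beta_kernel x y u : 0 < u < 1 ->
  {for u, continuous (beta_kernel x y)}.
Proof.
move=> /andP[u0 u1]; apply: cvgM; first exact: continuous_powR.
suff : {for u, continuous (fun v : R => (1 - v) `^ (y - 1))} by [].
apply/differentiable_continuous/derivable1_diffP.
exact: (@ex_derive _ _ _ _ _ _ _ (is_derive_onem_powR (y - 1) u1)).
Qed.

Lemma measurable_beta_kernel x y D : measurable_fun D (beta_kernel x y).
Proof.
apply: measurable_funTS; apply: measurable_funM; first exact: measurable_powR.
apply: (measurableT_comp (measurable_powR _)).
exact: measurable_funB.
Qed.

Lemma beta_kernel_split x y u : 0 < x -> 0 < y -> 0 < u < 1 ->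
  beta_kernel x y u = beta_kernel (x + 1) y u + beta_kernel x (y + 1) u.
Proof.
move=> x0 y0 /andP[u0 u1]; rewrite /beta_kernel !addrK.
have v0 : 0 <= 1 - u by rewrite subr_ge0 ltW.
by rewrite -(mulr_powRB1 (ltW u0) x0) -(mulr_powRB1 v0 y0); ring.
Qed.

(** The derivative of [v ^ x (1 - v) ^ y] is a combination of two Beta kernels in
    two ways, since the kernels at [(x + 1, y)] and [(x, y + 1)] add up to the one
    at [(x, y)].  Each way gives one recursion of the Beta function. *)
Lemma is_derive_bumpr x y u : 0 < x -> 0 < y -> 0 < u < 1 ->
  is_derive u 1 (fun v : R => v `^ x * (1 - v) `^ y)
    ((x + y) * beta_kernel x (y + 1) u - y * beta_kernel x y u).
Proof.
move=> x0 y0 u01; apply: is_derive_eq (is_derive_bump x y u01) _.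
by rewrite (@beta_kernel_split x y)//; ring.
Qed.

Lemma is_derive_bumpl x y u : 0 < x -> 0 < y -> 0 < u < 1 ->
  is_derive u 1 (fun v : R => v `^ x * (1 - v) `^ y)
    (x * beta_kernel x y u - (x + y) * beta_kernel (x + 1) y u).
Proof.
move=> x0 y0 u01; apply: is_derive_eq (is_derive_bump x y u01) _.
by rewrite (@beta_kernel_split x y)//; ring.
Qed.

(** With values in the extended reals, so that identities can be established
    before finiteness is known. *)
Definition ebeta x y : \bar R :=
  (\int[lebesgue_measure]_(u in `]0%R, 1%R[) (beta_kernel x y u)%:E)%E.

Lemma BetaE x y : Beta x y = fine (ebeta x y).
Proof. by []. Qed.

Lemma ebeta_ge0 x y : (0 <= ebeta x y)%E.
Proof. by apply: integral_ge0 => u _; rewrite lee_fin beta_kernel_ge0. Qed.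

Lemma cvg_ebeta x y :
  (\int[lebesgue_measure]_(u in cpt 1 n) (beta_kernel x y u)%:E @[n --> \oo]
    --> ebeta x y)%E.
Proof.
apply: cvg_integral_cpt => //; last exact: measurable_beta_kernel.
by move=> u _; exact: beta_kernel_ge0.
Qed.

Lemma in_cpt1 n u : cpt 1 n u -> 0 < u < 1.
Proof. by move=> /(sub_cpt ltr01); rewrite /= in_itv. Qed.

Lemma integrable_cpt (f : R -> R) n :
  (forall u, 0 < u < 1 -> {for u, continuous f}) ->
  lebesgue_measure.-integrable (cpt 1 n) (EFin \o f).
Proof.
move=> cf; apply: continuous_compact_integrable; first exact: segment_compact.
by apply: continuous_in_subspaceT => u; rewrite inE => /in_cpt1; exact: cf.
Qed.

Lemma gap_cvg_powR x : 0 < x -> (@gap R n) `^ x @[n --> \oo] --> (0 : R).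
Proof.
move=> x0; have /cvg_at_rightP h := @powR_cvg0 R x x0.
apply: h; split; first by move=> n; have /andP[] := @gap_bounds R n.
suff -> : @gap R = [sequence harmonic (n + 2)%N]_n.
  by rewrite (cvg_shiftn 2 (@harmonic R)); exact: cvg_harmonic.
by apply/funext => n; rewrite /= addn2.
Qed.

Lemma powR_le1 x u : 0 <= x -> 0 <= u <= 1 -> u `^ x <= 1.
Proof.
move=> x0 /andP[u0 u1].
by rewrite (le_trans (ge0_ler_powR x0 _ _ u1)) ?nnegrE// powR1.
Qed.

(** The boundary terms of an integration by parts vanish in the limit: on each
    side one factor tends to 0 and the other is at most 1. *)
Lemma bump_cvg0 x y : 0 < x -> 0 < y ->
  (1 - @gap R n) `^ x * (1 - (1 - @gap R n)) `^ y
    - (gap n) `^ x * (1 - gap n) `^ y @[n --> \oo] --> (0 : R).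
Proof.
move=> x0 y0; rewrite -[X in _ --> X](subrr 0).
apply: cvgB.
  apply: (@squeeze_cvgr _ _ _ _ (fun=> 0) (fun n => gap n `^ y)); last 2 first.
  - exact: cvg_cst.
  - exact: gap_cvg_powR.
  apply: nearW => n; have /andP[g0 g1] := @gap_bounds R n.
  rewrite mulr_ge0 ?powR_ge0//= subKr ler_piMl ?powR_ge0//.
  apply: powR_le1; lra.
apply: (@squeeze_cvgr _ _ _ _ (fun=> 0) (fun n => gap n `^ x)); last 2 first.
- exact: cvg_cst.
- exact: gap_cvg_powR.
apply: nearW => n; have /andP[g0 g1] := @gap_bounds R n.
rewrite mulr_ge0 ?powR_ge0//= ler_piMr ?powR_ge0//.
apply: powR_le1; lra.
Qed.

(** If [p] times one kernel exceeds [q] times another by the derivative of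
    [v ^ x (1 - v) ^ y], their integrals over compact intervals differ by a
    boundary term; letting the intervals grow removes it, whether or not the
    limits are finite. *)
Lemma ebeta_by_parts x y (p q : R) (x1 y1 x2 y2 : R) : 0 < x -> 0 < y ->
  0 <= p -> 0 <= q ->
  (forall u, 0 < u < 1 -> is_derive u 1 (fun v : R => v `^ x * (1 - v) `^ y)
    (p * beta_kernel x1 y1 u - q * beta_kernel x2 y2 u)) ->
  (p%:E * ebeta x1 y1 = q%:E * ebeta x2 y2)%E.
Proof.
move=> x0 y0 p0 q0 dF.
pose mu := @lebesgue_measure R.
pose r x y n := (\int[mu]_(u in cpt 1 n) (beta_kernel x y u)%:E)%E.
have cf (z w c : R) u : 0 < u < 1 -> {for u, continuous (fun u => c * beta_kernel z w u)}.
  by move=> u01; apply: cvgM; [exact: cvg_cst|exact: continuous_beta_kernel].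
have rZ z w c n : 0 <= c ->
    (c%:E * r z w n = \int[mu]_(u in cpt 1 n) (c * beta_kernel z w u)%:E)%E.
  move=> c0; rewrite /r -ge0_integralZl//.
  - exact: measurable_cpt.
  - by apply/measurable_EFinP; exact: measurable_beta_kernel.
  - by move=> u _; rewrite lee_fin beta_kernel_ge0.
have key n : (p%:E * r x1 y1 n = q%:E * r x2 y2 n +
    ((1 - gap n) `^ x * (1 - (1 - gap n)) `^ y - (gap n) `^ x * (1 - gap n) `^ y)%:E)%E.
  rewrite -(@FTC_cpt R (fun v : R => v `^ x * (1 - v) `^ y)
     (fun u => p * beta_kernel x1 y1 u - q * beta_kernel x2 y2 u))//; last first.
    by move=> u u01; apply: cvgB; exact: cf.
  rewrite !rZ//.
  rewrite -integralD//=; last 3 first.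
  - exact: measurable_cpt.
  - apply: integrable_cpt; exact: cf.
  - by apply: integrable_cpt => u u01; apply: cvgB; exact: cf.
  by apply: eq_integral => u _; rewrite -EFinD addrC subrK.
have c1 : (p%:E * r x1 y1 n @[n --> \oo] --> p%:E * ebeta x1 y1)%E.
  by apply: cvgeZl => //; exact: cvg_ebeta.
have c2 : (p%:E * r x1 y1 n @[n --> \oo] --> q%:E * ebeta x2 y2 + 0)%E.
  under eq_fun do rewrite key.
  apply: cvgeD.
  - by rewrite fin_num_adde_defl.
  - by apply: cvgeZl => //; exact: cvg_ebeta.
  - by apply: cvg_EFin; [exact: nearW|exact: bump_cvg0].
by rewrite -[RHS]adde0; exact: (cvg_unique _ c1 c2).
Qed.

Lemma ebeta_recr x y : 0 < x -> 0 < y ->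
  ((x + y)%:E * ebeta x (y + 1) = y%:E * ebeta x y)%E.
Proof.
move=> x0 y0; apply: (@ebeta_by_parts x y) => //; rewrite ?addr_ge0 ?ltW//.
by move=> u; exact: is_derive_bumpr.
Qed.

Lemma ebeta_recl x y : 0 < x -> 0 < y ->
  (x%:E * ebeta x y = (x + y)%:E * ebeta (x + 1) y)%E.
Proof.
move=> x0 y0; apply: (@ebeta_by_parts x y) => //; rewrite ?addr_ge0 ?ltW//.
by move=> u; exact: is_derive_bumpl.
Qed.

End BetaKernel.

Section BetaFunction.
Context {R : realType}.
Implicit Types x y u : R.
Notation mu := (@lebesgue_measure R).

Lemma ebeta_lty_gt1 x y : 0 < x -> 0 < y -> (ebeta (x + 1) (y + 1) < +oo)%E.
Proof.
move=> x0 y0.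
have : (ebeta (x + 1) (y + 1) <= \int[mu]_(u in `]0%R, 1%R[) 1)%E.
  apply: ge0_le_integral => //.
  - by move=> u _; rewrite lee_fin beta_kernel_ge0.
  - by apply/measurable_EFinP; exact: measurable_beta_kernel.
  - move=> u; rewrite /= in_itv/= => /andP[u0 u1].
    rewrite lee_fin /beta_kernel !addrK mulr_ile1 ?powR_ge0//; apply: powR_le1; lra.
move=> /le_lt_trans; apply.
by rewrite integral_cst//= mul1e lebesgue_measure_itv/= lte_fin ltr01 oppr0 adde0 ltry.
Qed.

(** The kernel at [(x + 1, y + 1)] is bounded by 1, and finiteness travels back
    along the two recursions. *)
Lemma ebeta_fin x y : 0 < x -> 0 < y -> ebeta x y \is a fin_num.
Proof.
move=> x0 y0; rewrite ge0_fin_numE ?ebeta_ge0//.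
have x1 : 0 < x + 1 by rewrite addr_gt0.
have lt_mul (c : R) (e : \bar R) : 0 < c -> (0 <= e)%E -> (c%:E * e < +oo)%E -> (e < +oo)%E.
  by case: e => [r| |] c0 _; rewrite ?ltry ?ltNyr// gt0_muley ?lte_fin.
apply: (lt_mul x) => //; first exact: ebeta_ge0.
rewrite ebeta_recl// lte_mul_pinfty ?lee_fin ?addr_ge0 ?ltW//.
apply: (lt_mul y) => //; first exact: ebeta_ge0.
rewrite -ebeta_recr// lte_mul_pinfty ?lee_fin ?addr_ge0 ?ltW//.
exact: ebeta_lty_gt1.
Qed.

Lemma EFin_Beta x y : 0 < x -> 0 < y -> (Beta x y)%:E = ebeta x y.
Proof. by move=> x0 y0; rewrite BetaE fineK// ebeta_fin. Qed.

Lemma Beta_recr x y : 0 < x -> 0 < y ->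
  (x + y) * Beta x (y + 1) = y * Beta x y.
Proof.
move=> x0 y0; have y1 : 0 < y + 1 by rewrite addr_gt0.
have := ebeta_recr x0 y0.
by rewrite -(EFin_Beta x0 y0) -(EFin_Beta x0 y1) -EFinM -EFinM => h; exact: (EFin_inj h).
Qed.

Lemma Beta_recl x y : 0 < x -> 0 < y ->
  x * Beta x y = (x + y) * Beta (x + 1) y.
Proof.
move=> x0 y0; have x1 : 0 < x + 1 by rewrite addr_gt0.
have := ebeta_recl x0 y0.
by rewrite -(EFin_Beta x0 y0) -(EFin_Beta x1 y0) -EFinM -EFinM => h; exact: (EFin_inj h).
Qed.

(** The kernel at [(x, 1)] is [u ^ (x - 1)], with primitive [u ^ x / x]. *)
Lemma Beta1 x : 0 < x -> x * Beta x 1 = 1.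
Proof.
move=> x0; suff : (x%:E * ebeta x 1 = 1)%E.
  by rewrite -(EFin_Beta x0 ltr01) -EFinM => h; exact: (EFin_inj h).
have x0' : 0 <= x by exact: ltW.
have c1 : (x%:E * \int[mu]_(u in cpt 1 n) (beta_kernel x 1 u)%:E @[n --> \oo]
    --> x%:E * ebeta x 1)%E by apply: cvgeZl => //; exact: cvg_ebeta.
apply: (cvg_unique _ c1) => //.
suff -> : (fun n => x%:E * \int[mu]_(u in cpt 1 n) (beta_kernel x 1 u)%:E)%E =
    (fun n => ((1 - gap n) `^ x - gap n `^ x)%:E).
  apply: cvg_EFin; first exact: nearW.
  rewrite -[X in _ --> X]subr0; apply: cvgB; last exact: gap_cvg_powR.
  have e1 : 1 `^ x = 1 :> R by rewrite powR1.
  rewrite -[X in _ --> X]e1.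
  apply: (@cvg_comp _ _ _ (fun n => 1 - gap n) (fun v : R => v `^ x) _ (nbhs (1 : R)));
    last exact: continuous_powR.
  suff : 1 - gap n @[n --> \oo] --> (1 : R) by [].
  rewrite -[X in _ --> X]subr0; apply: cvgB; first exact: cvg_cst.
  have := @gap_cvg_powR R 1 ltr01.
  by apply: cvg_near_eq; apply: nearW => n; rewrite powRr1// invr_ge0.
apply/funext => n.
have dF (u : R) : 0 < u < 1 ->
    is_derive u 1 (fun v : R => v `^ x) (x * beta_kernel x 1 u).
  move=> /andP[u0 u1]; rewrite /beta_kernel subrr powRr0 mulr1.
  exact: is_derive1_powR.
have cf (u : R) : 0 < u < 1 -> {for u, continuous (fun u => x * beta_kernel x 1 u)}.
  by move=> u01; apply: cvgM; [exact: cvg_cst|exact: continuous_beta_kernel].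
rewrite -(FTC_cpt n dF cf) -ge0_integralZl//.
- exact: measurable_cpt.
- by apply/measurable_EFinP; exact: measurable_beta_kernel.
- by move=> u _; rewrite lee_fin beta_kernel_ge0.
Qed.

End BetaFunction.

(** * Euler's limit for the Gamma function *)

Section Gauss.
Context {R : realType}.
Implicit Types x y t : R.
Notation mu := (@lebesgue_measure R).

(** An integrable bound, uniform in [n >= 2], for the kernels
    [t ^ (x - 1) (1 - t / n) ^ (y + n - 1)].  The exponent is halved because
    [(y + n - 1) / n] is only known to exceed 1 / 2 when [y] is small. *)
Definition gamma_dom x t : R := t `^ (x - 1) * expR (- (t / 2)).

Lemma measurable_gamma_dom x : measurable_fun setT (gamma_dom x).
Proof.
apply: measurable_funM; first exact: measurable_powR.
apply: measurableT_comp => //; apply: measurableT_comp => //.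
exact: mulrr_measurable.
Qed.

Lemma gamma_dom_ge0 x t : 0 <= gamma_dom x t.
Proof. by rewrite mulr_ge0 ?powR_ge0 ?expR_ge0. Qed.

Lemma gamma_dom_tail x : exists2 C : R, 0 <= C &
  forall t, 1 <= t -> gamma_dom x t <= C * t `^ (-2).
Proof.
(* The term of order [m.+1] of the exponential series beats [t ^ (x + 1)]. *)
have [m hm] : exists m, x + 1 <= m.+1%:R.
  exists (Num.truncn `|x + 1|); rewrite (le_trans (ler_norm _))// ltW//.
  exact: truncnS_gt.
exists (2 ^+ m.+1 * m.+1`!%:R); first by rewrite mulr_ge0// exprn_ge0.
move=> t t1; have t0 : 0 < t by rewrite (lt_le_trans _ t1).
have h : t ^+ m.+1 * expR (- (t / 2)) <= 2 ^+ m.+1 * m.+1`!%:R.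
  rewrite expRN ler_pdivrMr ?expR_gt0//.
  have t2 : 0 <= t / 2 by rewrite divr_ge0// ltW.
  have h := expR_ge1Dxn m t2.
  have {}h : (t / 2) ^+ m.+1 / m.+1`!%:R <= expR (t / 2).
    by rewrite (le_trans _ h)// lerDr.
  move: h; rewrite ler_pdivrMr ?ltr0n ?fact_gt0// expr_div_n.
  rewrite ler_pdivrMr ?exprn_gt0// => /le_trans; apply.
  by rewrite mulrC (mulrC (expR _)) mulrA.
have e1 : t `^ (x - 1) <= t ^+ m.+1 * t `^ (- 2).
  rewrite -(powR_mulrn _ (ltW t0)) -powRD; last by rewrite (gt_eqF t0) implybT.
  by apply: ler_powR => //; lra.
rewrite /gamma_dom (le_trans (ler_wpM2r (expR_ge0 _) e1))//.
by rewrite mulrAC ler_wpM2r// powR_ge0.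
Qed.

Lemma integral_powRN2_lty : (\int[mu]_(t in `[1%R, +oo[) (t `^ (-2))%:E < +oo)%E.
Proof.
rewrite (@ge0_continuous_FTC2y _ _ (fun t => - t `^ (-1)) 1 0).
- by rewrite -EFinB ltry.
- by move=> t _; exact: powR_ge0.
- apply: continuous_in_subspaceT => t; rewrite inE/= in_itv/= andbT => t1.
  by apply: continuous_powR; rewrite (lt_le_trans _ t1).
- rewrite -oppr0; apply: cvgN.
  have h : (t : R)^-1 @[t --> +oo] --> (0 : R).
    by apply/gtr0_cvgV0; [exact: nbhs_pinfty_gt|exact: cvg_id].
  apply: cvg_trans h; apply: near_eq_cvg; near=> t.
  have t0 : 0 <= t by near: t; exact: nbhs_pinfty_ge.
  by rewrite powR_inv1.
- move=> t t1; apply: derivableN.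
  exact: (@ex_derive _ _ _ _ _ _ _ (is_derive1_powR (-1) (lt_trans ltr01 t1))).
- apply: cvg_at_right_filter; apply: cvgN; exact: continuous_powR.
- move=> t; rewrite in_itv/= andbT => t1; rewrite derive1E.
  have h := is_derive1_powR (-1) (lt_trans ltr01 t1).
  rewrite (@derive_val _ _ _ _ _ _ _ (is_deriveN h)).
  rewrite mulN1r opprK; congr (_ `^ _); lra.
Unshelve. all: by end_near. Qed.

(** Below 1 the bound is dominated by the Beta kernel at [(x, 1)], above 1 by a
    multiple of [t ^ (- 2)]. *)
Lemma integrable_gamma_dom x : 0 < x ->
  mu.-integrable `]0, +oo[ (EFin \o gamma_dom x).
Proof.
move=> x0; apply/integrableP; split.
  by apply/measurable_EFinP/measurable_funTS; exact: measurable_gamma_dom.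
under eq_integral do rewrite /= ger0_norm ?gamma_dom_ge0//.
have mg D : measurable_fun D (EFin \o gamma_dom x).
  by apply/measurable_EFinP/measurable_funTS; exact: measurable_gamma_dom.
rewrite (@itv_bndbnd_setU _ _ _ (BLeft 1))//.
rewrite ge0_integral_setU//=; last first.
  rewrite disj_set2E; apply/eqP; rewrite -subset0 => t [] /=.
  rewrite !in_itv/= andbT => /andP[_ t1] t1'.
  by move: (lt_le_trans t1 t1'); rewrite ltxx.
- by move=> t _; rewrite lee_fin gamma_dom_ge0.
- exact: mg.
2: by rewrite bnd_simp.
apply: lte_add_pinfty.
  apply: (@le_lt_trans _ _ (ebeta x 1)); last first.
    by rewrite -EFin_Beta// ltry.
  apply: ge0_le_integral => //.
  - by move=> t _; rewrite lee_fin gamma_dom_ge0.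
  - exact: mg.
  - by apply/measurable_EFinP; exact: measurable_beta_kernel.
  - move=> t; rewrite /= in_itv/= => /andP[t0 t1].
    rewrite lee_fin /gamma_dom /beta_kernel subrr powRr0 mulr1.
    by rewrite ler_piMr ?powR_ge0// expR_le1; lra.
have [C C0 hC] := gamma_dom_tail x.
apply: (@le_lt_trans _ _ (\int[mu]_(t in `[1%R, +oo[) (C%:E * (t `^ (-2))%:E))%E).
  apply: ge0_le_integral => //.
  - by move=> t _; rewrite lee_fin gamma_dom_ge0.
  - exact: mg.
  - apply/measurable_EFinP; apply: measurable_funM => //.
    by apply: measurable_funTS; exact: measurable_powR.
  - by move=> t; rewrite /= in_itv/= andbT => t1; rewrite lee_fin hC.
rewrite ge0_integralZl//.
- by rewrite lte_mul_pinfty ?lee_fin// integral_powRN2_lty.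
- by apply/measurable_EFinP/measurable_funTS; exact: measurable_powR.
- by move=> t _; rewrite lee_fin powR_ge0.
Qed.
End Gauss.

Section GaussLimit.
Context {R : realType}.
Implicit Types x y t : R.
Notation mu := (@lebesgue_measure R).

Definition gamma_kernel x t : R := t `^ (x - 1) * expR (- t).

Lemma GammaE x :
  Gamma x = fine (\int[mu]_(t in `]0%R, +oo[) (gamma_kernel x t)%:E)%E.
Proof. by []. Qed.

Lemma measurable_gamma_kernel x D : measurable_fun D (gamma_kernel x).
Proof.
apply: measurable_funTS; apply: measurable_funM; first exact: measurable_powR.
by apply: measurableT_comp => //; exact: measurableT_comp.
Qed.

(** The logarithm is squeezed by [- z / (1 - z) <= ln (1 - z) <= - z] at
    [z = t / n]. *)
Lemma cvg_powR_expR y t : 0 < t ->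
  (1 - t / n%:R) `^ (y + n%:R - 1) @[n --> \oo] --> expR (- t).
Proof.
move=> t0.
have lnV1 (z : R) : 0 < z < 1 -> - (z / (1 - z)) <= ln (1 - z) <= - z.
  move=> /andP[z0 z1]; apply/andP; split; last first.
    by apply: le_ln1Dx; rewrite ltrN2.
  have w0 : 0 < 1 - z by rewrite subr_gt0.
  rewrite lerNl -lnV ?posrE//.
  have e : (1 - z)^-1 = 1 + z / (1 - z) by field; exact: lt0r_neq0.
  rewrite [in leLHS]e.
  by apply: le_ln1Dx; rewrite (@lt_le_trans _ _ 0)// divr_ge0// ltW.
suff h : (y + n%:R - 1) * ln (1 - t / n%:R) @[n --> \oo] --> - t.
  have {}h : expR ((y + n%:R - 1) * ln (1 - t / n%:R)) @[n --> \oo] --> expR (- t).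
    exact: (@continuous_cvg _ _ _ _ _ _ expR _ (@continuous_expR R (- t)) h).
  apply: cvg_near_eq h; near=> n.
  have n0 : 0 < n%:R :> R by near: n; exact: nbhs_infty_gtr.
  have nt : t < n%:R :> R by near: n; exact: nbhs_infty_gtr.
  by rewrite /powR gt_eqF// subr_gt0 ltr_pdivrMr// mul1r.
apply: (@squeeze_cvgr _ _ _ _ (fun n => - t * ((n%:R + (y - 1)) / (n%:R + (- t))))
   (fun n => - t * ((n%:R + (y - 1)) / (n%:R + 0)))).
- near=> n.
  have n0 : 0 < n%:R :> R by near: n; exact: nbhs_infty_gtr.
  have nt : t < n%:R :> R by near: n; exact: nbhs_infty_gtr.
  have ny : 0 <= n%:R + (y - 1).
    rewrite -lerBlDr sub0r; near: n; exact: nbhs_infty_ger.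
  have /andP[l1 l2] : - (t / n%:R / (1 - t / n%:R)) <= ln (1 - t / n%:R) <= - (t / n%:R).
    by apply: lnV1; rewrite divr_gt0//= ltr_pdivrMr// mul1r.
  rewrite (_ : y + n%:R - 1 = n%:R + (y - 1)); last by ring.
  apply/andP; split.
    rewrite (_ : - t * _ = (n%:R + (y - 1)) * - (t / n%:R / (1 - t / n%:R))); last first.
      by field; rewrite !gt_eqF ?subr_gt0.
    exact: ler_wpM2l.
  rewrite (_ : - t * _ = (n%:R + (y - 1)) * - (t / n%:R)); last first.
    by field; rewrite gt_eqF.
  exact: ler_wpM2l.
- rewrite -[X in _ --> X]mulr1; apply: cvgM; first exact: cvg_cst.
  exact: cvg_ratio_natD.
- rewrite -[X in _ --> X]mulr1; apply: cvgM; first exact: cvg_cst.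
  exact: cvg_ratio_natD.
Unshelve. all: by end_near. Qed.

Definition gauss_approx x y (n : nat) t : R :=
  t `^ (x - 1) * (1 - t / n%:R) `^ (y + n%:R - 1).

Lemma measurable_gauss_approx x y n D : measurable_fun D (gauss_approx x y n).
Proof.
apply: measurable_funTS; apply: measurable_funM; first exact: measurable_powR.
apply: (measurableT_comp (measurable_powR _)).
by apply: measurable_funB => //; exact: mulrr_measurable.
Qed.

Lemma gauss_approx_ge0 x y n t : 0 <= gauss_approx x y n t.
Proof. by rewrite mulr_ge0// powR_ge0. Qed.

Lemma gauss_approx_le x y n t : 0 < y -> (2 <= n)%N -> 0 < t < n%:R ->
  gauss_approx x y n t <= gamma_dom x t.
Proof.
move=> y0 n2 /andP[t0 tn]; apply: ler_wpM2l; first exact: powR_ge0.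
have n2' : 2 <= n%:R :> R by rewrite ler_nat.
have n0 : 0 < n%:R :> R by lra.
have z1 : t / n%:R < 1 by rewrite ltr_pdivrMr// mul1r.
rewrite /powR gt_eqF ?subr_gt0// ler_expR.
have h : ln (1 - t / n%:R) <= - (t / n%:R) by apply: le_ln1Dx; rewrite ltrN2.
have h2 : 0 <= y + n%:R - 1 by lra.
rewrite (le_trans (ler_wpM2l h2 h))//.
rewrite mulrN lerN2 mulrA ler_pdivlMr//.
suff : t * (n%:R / 2) <= t * (y + n%:R - 1) by lra.
by apply: ler_wpM2l; [exact: ltW|lra].
Qed.

(** The substitution [u = t / n] in the Beta integral. *)
Lemma powR_Beta_gauss x y n : 0 < x -> 0 < y -> (0 < n)%N ->
  ((n%:R `^ x * Beta x (y + n%:R))%:E =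
   \int[mu]_(t in `]0%R, n%:R[) (gauss_approx x y n t)%:E)%E.
Proof.
move=> x0 y0 n0.
have n0' : 0 < n%:R :> R by rewrite ltr0n.
have yn : 0 < y + n%:R by rewrite addr_gt0.
have := @integral_scale R n%:R (beta_kernel x (y + n%:R)) n0'
  (fun u _ => beta_kernel_ge0 _ _ _)
  (@continuous_beta_kernel R x (y + n%:R)) (@measurable_beta_kernel R _ _ _).
rewrite -/(ebeta x (y + n%:R)) -(EFin_Beta x0 yn) -EFinM => h.
rewrite -(mulr_powRB1 (ltW n0') x0) mulrAC EFinM -h.
rewrite muleC -ge0_integralZl//; last 2 first.
- apply/measurable_EFinP; apply: measurable_funTS.
  apply: (measurableT_comp (@measurable_beta_kernel R _ _ _)).
  exact: mulrr_measurable.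
- by move=> t _; rewrite lee_fin beta_kernel_ge0.
apply: eq_integral => t; rewrite inE/= in_itv/= => /andP[t0 tn].
rewrite -EFinM; congr (_%:E); rewrite /beta_kernel /gauss_approx mulrA.
by rewrite -powRM ?divr_ge0 ?ltW// mulrCA divff ?mulr1// gt_eqF.
Qed.

Lemma integrable_gamma_kernel x : 0 < x ->
  mu.-integrable `]0, +oo[ (EFin \o gamma_kernel x).
Proof.
move=> x0; apply: le_integrable (integrable_gamma_dom x0) => //.
  by apply/measurable_EFinP; exact: measurable_gamma_kernel.
move=> t; rewrite /= in_itv/= andbT => t0.
rewrite lee_fin !ger0_norm ?gamma_dom_ge0 ?mulr_ge0 ?powR_ge0 ?expR_ge0//.
by apply: ler_wpM2l; [exact: powR_ge0|rewrite ler_expR; lra].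
Qed.

(** Euler's limit: after the substitution [u = t / n] the Beta kernel tends to
    the Gamma kernel, dominated by [gamma_dom]. *)
Lemma cvg_Beta_Gamma x y : 0 < x -> 0 < y ->
  n%:R `^ x * Beta x (y + n%:R) @[n --> \oo] --> Gamma x.
Proof.
move=> x0 y0.
pose D : set R := `]0, +oo[%classic.
(* Starting at [n = 2], where the domination begins. *)
pose f n : R -> R := (gauss_approx x y n.+2) \_ (`]0, n.+2%:R[%classic : set R).
have mf n : measurable_fun D (EFin \o f n).
  apply/measurable_EFinP/measurable_funTS; apply/(measurable_restrictT _ _).1 => //.
  exact: measurable_gauss_approx.
have ff t : D t -> (f n t)%:E @[n --> \oo] --> (gamma_kernel x t)%:E.
  rewrite /D/= in_itv/= andbT => t0; apply: cvg_EFin; first exact: nearW.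
  have h := cvg_powR_expR y t0.
  have {}h : t `^ (x - 1) * (1 - t / n%:R) `^ (y + n%:R - 1) @[n --> \oo]
    --> gamma_kernel x t by apply: cvgM => //; exact: cvg_cst.
  rewrite -(cvg_shiftn 2) in h.
  apply: cvg_near_eq h; near=> n.
  have nt : t < n%:R by near: n; exact: nbhs_infty_gtr.
  have nt2 : t < n.+2%:R by rewrite (lt_le_trans nt)// ler_nat ltnW.
  by rewrite /f patchE mem_set ?addn2//= in_itv/= t0.
have fg n t : D t -> (`|(f n t)%:E| <= (gamma_dom x t)%:E)%E.
  rewrite /D/= in_itv/= andbT => t0; rewrite lee_fin /f patchE.
  case: ifPn => [|_]; last by rewrite normr0 gamma_dom_ge0.
  rewrite inE/= in_itv/= => tn.
  by rewrite ger0_norm ?gauss_approx_ge0// gauss_approx_le.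
have gfin t : D t -> (EFin \o gamma_dom x) t \is a fin_num by [].
have key := @dominated_cvg _ _ _ mu D (measurable_itv _) _ _ _ mf ff
  gfin (integrable_gamma_dom x0) fg.
have fin : (\int[mu]_(t in D) (gamma_kernel x t)%:E)%E \is a fin_num.
  have h := integrable_gamma_kernel x0.
  apply: (@integrable_fin_num _ _ _ mu D _ (EFin \o gamma_kernel x)).
  - exact: measurable_itv.
  - exact: h.
rewrite -(cvg_shiftn 2) GammaE.
move: key; rewrite -(fineK fin) => /fine_cvg; apply: cvg_near_eq.
apply: nearW => n /=; rewrite addn2.
suff -> : (\int[mu]_(t in D) (f n t)%:E = (n.+2%:R `^ x * Beta x (y + n.+2%:R))%:E)%E by [].
rewrite powR_Beta_gauss//.
have sub : `]0, n.+2%:R[%classic `<=` D.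
  by move=> t; rewrite /D /= !in_itv/= andbT => /andP[].
rewrite -(setIidr sub) integral_mkcondr.
by apply: eq_integral => t _; rewrite /f !patchE; case: ifPn.
Unshelve. all: by end_near. Qed.

(** Restricted to [`]0, 1[], the Gamma kernel is at least [exp (- 1)] times the
    Beta kernel at [(x, 1)]. *)
Lemma Gamma_gt0 x : 0 < x -> 0 < Gamma x.
Proof.
move=> x0; rewrite -lte_fin GammaE fineK; last first.
  by apply: integrable_fin_num => //; exact: integrable_gamma_kernel.
apply: (@lt_le_trans _ _ (\int[mu]_(t in `]0%R, 1%R[) (gamma_kernel x t)%:E)%E); last first.
  apply: ge0_subset_integral => //.
  - by apply/measurable_EFinP; exact: measurable_gamma_kernel.
  - by move=> t _; rewrite lee_fin mulr_ge0 ?powR_ge0 ?expR_ge0.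
  - by move=> t; rewrite /= !in_itv/= andbT => /andP[].
apply: (@lt_le_trans _ _ (\int[mu]_(t in `]0%R, 1%R[)
    ((expR (- 1))%:E * (beta_kernel x 1 t)%:E))%E).
  rewrite ge0_integralZl//.
  - rewrite -/(ebeta x 1) -EFin_Beta// -EFinM lte_fin mulr_gt0 ?expR_gt0//.
    by rewrite -(pmulr_rgt0 _ x0) Beta1.
  - by apply/measurable_EFinP; exact: measurable_beta_kernel.
  - by move=> t _; rewrite lee_fin beta_kernel_ge0.
apply: ge0_le_integral => //.
- by move=> t _; rewrite -EFinM lee_fin mulr_ge0 ?expR_ge0 ?beta_kernel_ge0.
- apply/measurable_EFinP; apply: measurable_funM => //.
  exact: measurable_beta_kernel.
- by apply/measurable_EFinP; exact: measurable_gamma_kernel.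
- move=> t; rewrite /= in_itv/= => /andP[t0 t1].
  rewrite -EFinM lee_fin /beta_kernel subrr powRr0 mulr1 mulrC.
  by apply: ler_wpM2l; [exact: powR_ge0|rewrite ler_expR; lra].
Qed.

End GaussLimit.

(** * Growth of the products of the 1 + c / k *)

Section RisingProducts.
Context {R : realType}.
Implicit Types a b c x y : R.

Definition rising c (n : nat) : R := \prod_(1 <= k < n) (1 + c / k%:R).

Lemma rising1 c : rising c 1 = 1.
Proof. by rewrite /rising big_geq. Qed.

Lemma risingS c n : (0 < n)%N -> rising c n.+1 = rising c n * (1 + c / n%:R).
Proof. by move=> n0; rewrite /rising big_nat_recr. Qed.

Lemma rising_factor_gt0 c k : -1 < c -> (0 < k)%N -> 0 < 1 + c / k%:R :> R.
Proof.
move=> c1 k0; have k1 : 1 <= k%:R :> R by rewrite ler1n.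
rewrite -ltrBlDl sub0r ltr_pdivlMr; last lra.
rewrite mulN1r; lra.
Qed.

Lemma rising_gt0 c n : -1 < c -> 0 < rising c n.
Proof.
move=> c1; rewrite /rising big_seq_cond; apply: prodr_gt0 => k.
by rewrite mem_index_iota andbT => /andP[k0 _]; exact: rising_factor_gt0.
Qed.

(** The recursion of [Beta (c + 1)] in its second argument is the one of the
    inverse of [(n + c) * rising c n]. *)
Lemma rising_Beta c n : -1 < c -> (0 < n)%N ->
  rising c n * (n%:R + c) * Beta (c + 1) n%:R = 1.
Proof.
move=> c1; have c0 : 0 < c + 1 by lra.
move=> n0; rewrite -(prednK n0); elim: n.-1 => [|{n0}m IH].
  by rewrite rising1 mul1r addrC (Beta1 c0).
rewrite (risingS _ (ltn0Sn _)).
have n1 : 0 < m.+1%:R :> R by rewrite ltr0n.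
have := Beta_recr c0 n1; rewrite natr1 => h.
rewrite -[RHS]IH -!mulrA; congr (_ * _).
have -> : m.+2%:R + c = c + 1 + m.+1%:R :> R by rewrite -[m.+2%:R]natr1; ring.
rewrite h; field; exact: lt0r_neq0.
Qed.

Lemma cvg_natr_Beta c y : 0 < c -> 0 <= y ->
  n%:R `^ c * Beta c (y + n%:R) @[n --> \oo] --> Gamma c.
Proof.
move=> c0; rewrite le_eqVlt => /predU1P[<-|]; last exact: cvg_Beta_Gamma.
have h : (n%:R + c) / (n%:R + 0) * (n%:R `^ c * Beta c (1 + n%:R)) @[n --> \oo]
    --> 1 * Gamma c.
  by apply: cvgM; [exact: cvg_ratio_natD|exact: cvg_Beta_Gamma].
rewrite mul1r in h; apply: cvg_near_eq h; near=> n.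
have n0 : 0 < n%:R :> R by near: n; exact: nbhs_infty_gtr.
have := Beta_recr c0 n0 => e.
rewrite add0r addr0 [1 + _]addrC.
apply: (mulfI (lt0r_neq0 n0)); rewrite [in RHS]mulrCA -e.
by field; exact: lt0r_neq0.
Unshelve. all: by end_near. Qed.

(** Euler's limit at [x] and at [x + 1], compared by the recursion of the Beta
    function in its first argument. *)
Lemma GammaS x : 0 < x -> Gamma (x + 1) = x * Gamma x.
Proof.
move=> x0; have x1 : 0 < x + 1 by rewrite addr_gt0.
have h1 : x * (n%:R `^ x * Beta x (1 + n%:R)) @[n --> \oo] --> x * Gamma x.
  by apply: cvgM; [exact: cvg_cst|exact: cvg_Beta_Gamma].
have h2 : (n%:R + (x + 1)) / (n%:R + 0) * (n%:R `^ (x + 1) * Beta (x + 1) (1 + n%:R))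
    @[n --> \oo] --> 1 * Gamma (x + 1).
  by apply: cvgM; [exact: cvg_ratio_natD|exact: cvg_Beta_Gamma].
rewrite mul1r in h2.
suff h3 : x * (n%:R `^ x * Beta x (1 + n%:R)) @[n --> \oo] --> Gamma (x + 1).
  exact: (cvg_unique _ h3 h1).
apply: cvg_near_eq h2; near=> n.
have n0 : 0 < n%:R :> R by near: n; exact: nbhs_infty_gtr.
have n1 : 0 < 1 + n%:R :> R by rewrite addr_gt0.
have e := Beta_recl x0 n1.
rewrite [in RHS]mulrCA e -(mulr_powRB1 (ltW n0) x1) addrK.
by field; exact: lt0r_neq0.
Unshelve. all: by end_near. Qed.

(** [rising_Beta] combined with Euler's limit at [c + 1]. *)
Lemma cvg_rising c : -1 < c ->
  rising c n / n%:R `^ c @[n --> \oo] --> (Gamma (c + 1))^-1.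
Proof.
move=> c1; have c0 : 0 < c + 1 by lra.
have g0 := lt0r_neq0 (Gamma_gt0 c0).
have h1 := cvg_natr_Beta c0 (lexx 0).
have h2 := cvg_seqV g0 h1.
have h3 := cvg_seqM (cvg_ratio_natD 0 c) h2; rewrite mul1r in h3.
apply: cvg_near_eq h3; near=> n.
have n0 : 0 < n%:R :> R by near: n; exact: nbhs_infty_gtr.
have nc : n%:R + c != 0 by near: n; exact: natD_neq0.
have n0' : (0 < n)%N by rewrite -(ltr0n R).
have e := rising_Beta c1 n0'.
have B0 : (n%:R + c) * Beta (c + 1) n%:R != 0.
  by apply/eqP => z; move/eqP: e; rewrite -mulrA z mulr0 eq_sym oner_eq0.
have rE : rising c n = ((n%:R + c) * Beta (c + 1) n%:R)^-1.
  by apply: (mulIf B0); rewrite mulVf// mulrA e.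
rewrite rE /= addr0 add0r -(mulr_powRB1 (ltW n0) c0) addrK !invfM.
have p0 : n%:R `^ c != 0 by rewrite gt_eqF// powR_gt0.
set B := (Beta _ _)^-1; field; rewrite p0 nc; exact: lt0r_neq0.
Unshelve. all: by end_near. Qed.

Lemma cvg_risingV c : 0 < c -> (rising c n)^-1 @[n --> \oo] --> (0 : R).
Proof.
move=> c0; have c1 : -1 < c by lra.
have g0 : Gamma (c + 1) != 0 by apply/lt0r_neq0/Gamma_gt0; lra.
have h1 := cvg_seqV (invr_neq0 g0) (cvg_rising c1).
have h2 := cvg_seqM (cvg_powR_natV c0) h1; rewrite mul0r in h2.
apply: cvg_near_eq h2; near=> n.
have n0 : 0 < n%:R :> R by near: n; exact: nbhs_infty_gtr.
have p0 : n%:R `^ c != 0 by rewrite gt_eqF// powR_gt0.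
have r0 := lt0r_neq0 (rising_gt0 n c1).
rewrite /= powRN; field; exact/andP.
Unshelve. all: by end_near. Qed.

(** The covariance, the variance of the number of moves and, for [b / 2 < a], the
    variance of the position are all governed by this ratio. *)
Definition rising_ratio a b n := (a + b) / b * rising (a + b) n / (rising a n * rising b n).

(** Iterating the recursion of [Beta (a + 1)] in its second argument from [b] up
    to [b + n]. *)
Lemma Beta_rising a b n : 0 < b -> -1 < a -> 0 <= a + b -> (0 < n)%N ->
  b * Beta (a + 1) b =
  (n%:R + (a + b)) * rising (a + b) n / rising b n * Beta (a + 1) (b + n%:R).
Proof.
move=> b0 a1 ab0 n0.
have a1_gt0 : 0 < a + 1 by lra.
have b1 : -1 < b by lra.
rewrite -(prednK n0); elim: n.-1 => [|{n0}m IH].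
  rewrite !rising1 divr1 mulr1 -(Beta_recr a1_gt0 b0); congr (_ * _); ring.
rewrite IH !(risingS _ (ltn0Sn _)).
have bn : 0 < b + m.+1%:R by rewrite addr_gt0.
have e1 : b + m.+1%:R + 1 = b + m.+2%:R by rewrite -addrA natr1.
have := Beta_recr a1_gt0 bn; rewrite e1 => h.
have n1 : 0 < m.+1%:R :> R by rewrite ltr0n.
have r0 := lt0r_neq0 (rising_gt0 m.+1 b1).
apply: (mulfI (lt0r_neq0 bn)); rewrite [LHS]mulrCA -h -[m.+2%:R]natr1.
have m0 : 0 <= m%:R :> R by [].
move: (rising b _) (rising (a + b) _) (Beta _ _) r0 => r p B r0.
clear -b0 bn n1 m0 r0.
by field; rewrite r0 !lt0r_neq0//; lra.
Qed.

(** By [Beta_rising] and [rising_Beta] the ratio is [(a + b) * Beta (a + 1) b] times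
    [(n + a) / (n + a + b)] and [Beta (a + 1) n / Beta (a + 1) (b + n)]; both tend
    to 1, the latter because Euler's limit does not depend on the shift [b]. *)
Lemma cvg_rising_ratio a b : 0 < b -> -1 < a -> 0 <= a + b ->
  rising_ratio a b n @[n --> \oo] --> (a + b) * Beta (a + 1) b.
Proof.
move=> b0 a1 ab0.
have a1_gt0 : 0 < a + 1 by lra.
have b1 : -1 < b by lra.
have g0 := lt0r_neq0 (Gamma_gt0 a1_gt0).
have h1 := cvg_natr_Beta a1_gt0 (lexx 0).
have h2 := cvg_natr_Beta a1_gt0 (ltW b0).
have h3 := cvg_seqM h1 (cvg_seqV g0 h2); rewrite divff// in h3.
have h4 := cvg_seqM (cvg_ratio_natD a (a + b)) h3; rewrite mul1r in h4.
have h5 := @cvg_seqZ _ _ ((a + b) * Beta (a + 1) b) _ h4.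
rewrite mulr1 in h5; apply: cvg_near_eq h5; near=> n.
have n0 : 0 < n%:R :> R by near: n; exact: nbhs_infty_gtr.
have n0' : (0 < n)%N by rewrite -(ltr0n R).
have nab : n%:R + (a + b) != 0 by near: n; exact: natD_neq0.
have : n%:R `^ (a + 1) * Beta (a + 1) (b + n%:R) != 0.
  near: n; exact: cvgr_neq0 g0.
rewrite mulf_eq0 negb_or => /andP[p0 B0].
have e1 := Beta_rising b0 a1 ab0 n0'.
have e2 := rising_Beta a1 n0'.
have ra := lt0r_neq0 (rising_gt0 n a1).
have rb := lt0r_neq0 (rising_gt0 n b1).
rewrite add0r.
have -> : Beta (a + 1) b =
  (n%:R + (a + b)) * rising (a + b) n / rising b n * Beta (a + 1) (b + n%:R) / b.
  by rewrite -e1 mulrC mulKf// gt_eqF.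
have -> : rising_ratio a b n =
    rising_ratio a b n * (rising a n * (n%:R + a) * Beta (a + 1) n%:R).
  by rewrite e2 mulr1.
rewrite /rising_ratio; clear e1 e2; move: B0 p0 ra rb.
move: (rising a n) (rising b n) (rising (a + b) n) => A r p.
move: (Beta (a + 1) (b + n%:R)) (Beta (a + 1) n%:R) => B B2 B0 p0 ra rb.
by field; rewrite ra rb (gt_eqF b0) nab B0 p0.
Unshelve. all: by end_near. Qed.

(** The partial product of the factors
    [(a + b + k) (1 + k) / ((a + 1 + k) (b + k))] for [k < n], written in terms
    of [rising_ratio].  The extra factor [n / (n + a)] is what puts all of them,
    the first one included, on the same side of 1, since
    [(a + b + k) (1 + k) - (a + 1 + k) (b + k) = a (1 - b)]. *)
Definition shifted_ratio a b n := rising_ratio a b n * (n%:R / (n%:R + a)).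

Lemma shifted_ratio1 a b : 0 < b -> -1 < a ->
  shifted_ratio a b 1 = (a + b) / (b * (1 + a)).
Proof.
move=> b0 a1; rewrite /shifted_ratio /rising_ratio !rising1; field.
by rewrite (gt_eqF b0) andbT lt0r_neq0//; lra.
Qed.

Lemma shifted_ratio_ge0 a b n : 0 < b -> -1 < a -> 0 <= a + b ->
  (0 < n)%N -> 0 <= shifted_ratio a b n.
Proof.
move=> b0 a1 ab0 n0; have n1 : 1 <= n%:R :> R by rewrite ler1n.
rewrite /shifted_ratio /rising_ratio !mulr_ge0 ?invr_ge0 ?mulr_ge0 ?(ltW (rising_gt0 _ _))//; lra.
Qed.

Lemma shifted_ratioS a b n : 0 < b -> -1 < a -> 0 <= a + b -> (0 < n)%N ->
  shifted_ratio a b n.+1 = shifted_ratio a b n *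
    ((a + b + n%:R) * (1 + n%:R) / ((a + 1 + n%:R) * (b + n%:R))).
Proof.
move=> b0 a1 ab0 n0; have n1 : 1 <= n%:R :> R by rewrite ler1n.
have b1 : -1 < b by lra.
have ra := lt0r_neq0 (rising_gt0 n a1).
have rb := lt0r_neq0 (rising_gt0 n b1).
rewrite /shifted_ratio /rising_ratio !(risingS _ n0) -[n.+1%:R]natr1.
field; rewrite ra rb (gt_eqF b0) /=.
by rewrite !lt0r_neq0//; lra.
Qed.

Lemma cvg_shifted_ratio a b : 0 < b -> -1 < a -> 0 <= a + b ->
  shifted_ratio a b n @[n --> \oo] --> (a + b) * Beta (a + 1) b.
Proof.
move=> b0 a1 ab0.
have h := cvg_seqM (cvg_rising_ratio b0 a1 ab0) (cvg_ratio_natD 0 a); rewrite mulr1 in h.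
by apply: cvg_near_eq h; near=> n; rewrite /= addr0.
Unshelve. all: by end_near. Qed.

(** The partial products increase from a first value above 1. *)
Lemma Beta_product_gt1 a b : 0 < b -> -1 < a -> 0 <= a + b -> b < 1 -> 0 < a ->
  1 < (a + b) * Beta (a + 1) b.
Proof.
move=> b0 a1 ab0 b_lt1 a_gt0.
have mono n : shifted_ratio a b 1 <= shifted_ratio a b n.+1.
  elim: n => [//|n /le_trans]; apply.
  rewrite [leRHS]shifted_ratioS// ler_peMr ?shifted_ratio_ge0//.
  have n0 : 0 <= n.+1%:R :> R by [].
  rewrite ler_pdivlMr ?mulr_gt0//; [|lra|lra].
  by rewrite mul1r -subr_ge0 (_ : _ - _ = a * (1 - b)); [apply: mulr_ge0; lra|ring].
have start : 1 < shifted_ratio a b 1.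
  rewrite shifted_ratio1// ltr_pdivlMr ?mulr_gt0//; last lra.
  by rewrite mul1r -subr_gt0 (_ : _ - _ = a * (1 - b)); [apply: mulr_gt0; lra|ring].
apply: (lt_le_trans start).
apply: (cvgr_to_ge (cvg_shifted_ratio b0 a1 ab0)); near=> n.
have n0 : (0 < n)%N by near: n; exact: nbhs_infty_gt.
by rewrite -(prednK n0).
Unshelve. all: by end_near. Qed.

(** The partial products decrease from a first value below 1.  The factor with
    [k = 0] vanishes when [a = - b], hence the weak inequalities. *)
Lemma Beta_product_lt1 a b : 0 < b -> -1 < a -> 0 <= a + b -> b < 1 -> a < 0 ->
  (a + b) * Beta (a + 1) b < 1.
Proof.
move=> b0 a1 ab0 b_lt1 a_lt0.
have mono n : shifted_ratio a b n.+1 <= shifted_ratio a b 1.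
  elim: n => [//|n]; apply: le_trans.
  rewrite [leLHS]shifted_ratioS// ler_piMr ?shifted_ratio_ge0//.
  have n0 : 0 <= n.+1%:R :> R by [].
  have n1 : 1 <= n.+1%:R :> R by rewrite ler1n.
  rewrite ler_pdivrMr ?mulr_gt0//; [|lra|lra].
  by rewrite mul1r -subr_ge0 (_ : _ - _ = - a * (1 - b)); [apply: mulr_ge0; lra|ring].
have start : shifted_ratio a b 1 < 1.
  rewrite shifted_ratio1// ltr_pdivrMr ?mulr_gt0//; last lra.
  by rewrite mul1r -subr_gt0 (_ : _ - _ = - a * (1 - b)); [apply: mulr_gt0; lra|ring].
apply: le_lt_trans start.
apply: (cvgr_to_le (cvg_shifted_ratio b0 a1 ab0)); near=> n.
have n0 : (0 < n)%N by near: n; exact: nbhs_infty_gt.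
by rewrite -(prednK n0).
Unshelve. all: by end_near. Qed.

End RisingProducts.

(** * Growth of the covariance and of the variances *)

Section MomentAsymptotics.
Context {R : realType}.
Implicit Types a b c s : R.

(** [(2 * s - 1) * cov_moves a b n] is the covariance of the position and the number
    of moves, and [cov_moves b b n] the variance of the number of moves. *)
Definition cov_moves a b n : R :=
  (a + b) / b * rising (a + b) n - a / b * rising a n - rising a n * rising b n.

Lemma cvg_powR_natM (u v : nat -> R) (p q l m : R) :
  u n / n%:R `^ p @[n --> \oo] --> l -> v n / n%:R `^ q @[n --> \oo] --> m ->
  (u n * v n) / n%:R `^ (p + q) @[n --> \oo] --> l * m.
Proof.
move=> hu hv; apply: cvg_near_eq (cvg_seqM hu hv); near=> n.
have n0 : 0 < n%:R :> R by near: n; exact: nbhs_infty_gtr.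
rewrite powRD; last by rewrite (gt_eqF n0) implybT.
by rewrite invfM mulrACA.
Unshelve. all: by end_near. Qed.

(** [cov_moves a b n] is [rising a n * rising b n] times
    [rising_ratio a b n - 1 - a / b / rising b n]. *)
Lemma cvg_cov_moves a b : 0 < b -> -1 < a -> 0 <= a + b ->
  cov_moves a b n / n%:R `^ (a + b) @[n --> \oo] -->
  ((a + b) * Beta (a + 1) b - 1) / (Gamma (a + 1) * Gamma (b + 1)).
Proof.
move=> b0 a1 ab0; have b1 : -1 < b by lra.
have h1 := cvg_powR_natM (cvg_rising a1) (cvg_rising b1).
have h2 := @cvg_seqBc _ _ 1 _ (cvg_rising_ratio b0 a1 ab0).
have h3 := @cvg_seqZ _ _ (a / b) _ (cvg_risingV b0); rewrite mulr0 in h3.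
have h4 := cvg_seqM (cvg_seqB h2 h3) h1.
rewrite subr0 -invfM in h4; apply: cvg_near_eq h4; near=> n.
have n0 : 0 < n%:R :> R by near: n; exact: nbhs_infty_gtr.
have p0 : n%:R `^ (a + b) != 0 by rewrite gt_eqF// powR_gt0.
have ra := lt0r_neq0 (rising_gt0 n a1).
have rb := lt0r_neq0 (rising_gt0 n b1).
rewrite /rising_ratio /cov_moves.
by field; rewrite ra rb p0 gt_eqF.
Unshelve. all: by end_near. Qed.

(** Second moment of the position when [b <> 2 * a]; [critical_moment] is the one
    for [b = 2 * a], where the forcing term of the recursion is resonant. *)
Definition square_moment a b n : R :=
  b / (b - 2 * a) * rising b n - 2 * a / (b - 2 * a) * rising (2 * a) n.

Definition critical_moment b n : R :=
  rising b n * (1 + \sum_(1 <= k < n) b / (k%:R + b)).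

(** For [b / 2 < a] the term [rising b n] is negligible, and [rising (2 * a) n] is
    compared with [rising a n ^+ 2] by [rising_ratio a a n]. *)
Lemma cvg_variance_super a b s : 0 < b < 1 -> b / 2 < a -> a <= b ->
  (square_moment a b n - (2 * s - 1) ^+ 2 * rising a n ^+ 2) / n%:R `^ (2 * a)
    @[n --> \oo] -->
  (a ^+ 2 * Beta a a - (2 * s - 1) ^+ 2 * (2 * a - b)) /
    ((2 * a - b) * Gamma (a + 1) ^+ 2).
Proof.
move=> /andP[b0 b1] ba ab; have a0 : 0 < a by lra.
have a1 : -1 < a by lra. have b1' : -1 < b by lra.
have aa : 0 <= a + a by lra.
have h1 := cvg_powR_natM (cvg_rising a1) (cvg_rising a1).
have c1 := cvg_rising_ratio a0 a1 aa.
have /cvg_seqM/(_ (cvg_rising b1')) c2 : n%:R `^ (- (2 * a - b)) @[n --> \oo] --> (0 : R).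
  by apply: cvg_powR_natV; lra.
rewrite mul0r in c2.
have c3 := @cvg_seqZ _ _ (a / (2 * a - b)) _ (cvg_seqM c1 h1).
have c4 := @cvg_seqZ _ _ (b / (2 * a - b)) _ c2; rewrite mulr0 in c4.
have c5 := @cvg_seqZ _ _ ((2 * s - 1) ^+ 2) _ h1.
have h := cvg_seqB (cvg_seqB c3 c4) c5.
have g0 : Gamma (a + 1) != 0 by apply/lt0r_neq0/Gamma_gt0; lra.
have d0 : 2 * a - b != 0 by apply: lt0r_neq0; lra.
rewrite (_ : _ / _ = a / (2 * a - b) *
    ((a + a) * Beta (a + 1) a * ((Gamma (a + 1))^-1 / Gamma (a + 1))) - 0 -
    (2 * s - 1) ^+ 2 * ((Gamma (a + 1))^-1 / Gamma (a + 1))); last first.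
  rewrite -(Beta_recl a0 a0); field; exact/andP.
apply: cvg_near_eq h; near=> n.
have n0 : 0 < n%:R :> R by near: n; exact: nbhs_infty_gtr.
have p0 : n%:R `^ (2 * a) != 0 by rewrite gt_eqF// powR_gt0.
have q0 : n%:R `^ b != 0 by rewrite gt_eqF// powR_gt0.
have ra := lt0r_neq0 (rising_gt0 n a1).
have -> : n%:R `^ (- (2 * a - b)) = n%:R `^ b / n%:R `^ (2 * a) :> R.
  by rewrite opprB powRB// (gt_eqF n0) implybT.
have d1 : b - 2 * a != 0 by rewrite -oppr_eq0 opprB.
rewrite /rising_ratio /square_moment (_ : a + a = 2 * a); last ring.
by field; rewrite ra p0 q0 d0 d1 gt_eqF.
Unshelve. all: by end_near. Qed.

(** Holds since [1 + 2 * a / k <= (1 + a / k) ^+ 2], with a nonnegative left-hand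
    side once [2 <= k]; the constant absorbs the factor with [k = 1], where
    [1 + 2 * a] may be negative. *)
Lemma rising_double_le a n : -1 < a -> (0 < n)%N ->
  `|rising (2 * a) n| <= (1 + (1 + a) ^- 2) * rising a n ^+ 2.
Proof.
move=> a1 n0; rewrite -(prednK n0); case: n.-1 => [|m].
  rewrite !rising1 normr1 expr1n mulr1 lerDl invr_ge0 sqr_ge0//.
elim: m => [|m IH].
  rewrite !(risingS _ (ltn0Sn _)) !rising1 !mul1r !divr1.
  rewrite (_ : _ * (1 + a) ^+ 2 = 1 + (1 + a) ^+ 2); last first.
    by field; rewrite lt0r_neq0//; lra.
  by rewrite ler_norml; apply/andP; split; nra.
rewrite (risingS _ (ltn0Sn m.+1)) [in leRHS](risingS _ (ltn0Sn m.+1)).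
rewrite normrM exprMn mulrA; apply: ler_pM => //.
have k2 : 2 <= m.+2%:R :> R by rewrite ler_nat.
have k0 : 0 < m.+2%:R :> R by lra.
rewrite ger0_norm; last first.
  by rewrite -lerBlDl sub0r ler_pdivlMr//; lra.
rewrite -subr_ge0 (_ : _ - _ = (a / m.+2%:R) ^+ 2) ?sqr_ge0//.
by field; rewrite lt0r_neq0//; lra.
Qed.

(** For [a < b / 2] both [rising (2 * a) n] and [rising a n ^+ 2] are negligible
    against [rising b n]. *)
Lemma cvg_variance_sub a b s : 0 < b < 1 -> - b <= a -> a < b / 2 ->
  (square_moment a b n - (2 * s - 1) ^+ 2 * rising a n ^+ 2) / n%:R `^ b
    @[n --> \oo] --> ((b - 2 * a) * Gamma b)^-1.
Proof.
move=> /andP[b0 b1] ba ab.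
have a1 : -1 < a by lra. have b1' : -1 < b by lra.
have h1 := cvg_powR_natM (cvg_rising a1) (cvg_rising a1).
have /cvg_seqM/(_ h1) c2 : n%:R `^ (- (b - 2 * a)) @[n --> \oo] --> (0 : R).
  by apply: cvg_powR_natV; lra.
rewrite mul0r in c2.
have {h1}c2 : rising a n ^+ 2 / n%:R `^ b @[n --> \oo] --> (0 : R).
  apply: cvg_near_eq c2; near=> n.
  have n0 : 0 < n%:R :> R by near: n; exact: nbhs_infty_gtr.
  have p0 : n%:R `^ (a + a) != 0 by rewrite gt_eqF// powR_gt0.
  have q0 : n%:R `^ b != 0 by rewrite gt_eqF// powR_gt0.
  rewrite opprB (_ : 2 * a = a + a); last ring.
  rewrite powRB ?(gt_eqF n0) ?implybT//.
  by field; rewrite p0 q0.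
have c3 : rising (2 * a) n / n%:R `^ b @[n --> \oo] --> (0 : R).
  have c4 := @cvg_seqZ _ _ (1 + (1 + a) ^- 2) _ c2; rewrite mulr0 in c4.
  have c5 := @cvg_seqZ _ _ (-1) _ c4; rewrite mulr0 in c5.
  apply: (squeeze_cvgr _ c5 c4); near=> n.
  have n0 : 0 < n%:R :> R by near: n; exact: nbhs_infty_gtr.
  have n0' : (0 < n)%N by rewrite -(ltr0n R).
  have q0 : 0 < n%:R `^ b by rewrite powR_gt0.
  rewrite mulN1r mulrA -ler_norml normrM (gtr0_norm (_ : 0 < _ ^-1)) ?invr_gt0//.
  by rewrite ler_pM2r ?invr_gt0// rising_double_le.
have g0 : Gamma b != 0 by apply/lt0r_neq0/Gamma_gt0; lra.
have d0 : b - 2 * a != 0 by apply: lt0r_neq0; lra.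
have c1 := @cvg_seqZ _ _ (b / (b - 2 * a)) _ (cvg_rising b1').
have c3' := @cvg_seqZ _ _ (2 * a / (b - 2 * a)) _ c3; rewrite mulr0 in c3'.
have c2' := @cvg_seqZ _ _ ((2 * s - 1) ^+ 2) _ c2; rewrite mulr0 in c2'.
have h := cvg_seqB (cvg_seqB c1 c3') c2'; rewrite !subr0 in h.
rewrite (GammaS b0) in h.
rewrite (_ : _^-1 = b / (b - 2 * a) / (b * Gamma b)); last first.
  by field; rewrite d0 g0 gt_eqF.
apply: cvg_near_eq h; near=> n.
have n0 : 0 < n%:R :> R by near: n; exact: nbhs_infty_gtr.
have q0 : n%:R `^ b != 0 by rewrite gt_eqF// powR_gt0.
by rewrite /square_moment; field; rewrite d0 q0.
Unshelve. all: by end_near. Qed.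

(** Both bounds telescope, by [ln (1 + x) <= x] at [x = 1 / (k + b)] and at
    [x = - 1 / (k + b)]. *)
Lemma sum_inv_ln b n : 0 < b -> (0 < n)%N ->
  ln (n%:R + b) - ln (1 + b) <= \sum_(1 <= k < n) (k%:R + b)^-1 <=
  ln (n%:R - 1 + b) - ln b.
Proof.
move=> b0 n0; rewrite -(prednK n0); elim: n.-1 => [|m /andP[IH1 IH2]].
  by rewrite big_geq// subrr subrr add0r subrr lexx.
have m0 : 0 < m.+1%:R :> R by [].
have m1 : 0 <= m%:R :> R by [].
have e1 : m.+1%:R = m%:R + 1 :> R by rewrite natr1.
have e2 : m.+2%:R = m%:R + 1 + 1 :> R by rewrite -natr1 e1.
rewrite big_nat_recr//=.
have x0 : 0 < m%:R + 1 + b by lra.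
have h1 : ln (m%:R + 1 + 1 + b) <= ln (m%:R + 1 + b) + (m%:R + 1 + b)^-1.
  rewrite -lerBlDl -ln_div ?posrE//; last lra.
  rewrite (_ : _ / _ = 1 + (m%:R + 1 + b)^-1); last by field; rewrite lt0r_neq0.
  by apply: le_ln1Dx; rewrite (@lt_trans _ _ 0)// invr_gt0.
have h2 : ln (m%:R + b) + (m%:R + 1 + b)^-1 <= ln (m%:R + 1 + b).
  have y0 : 0 < m%:R + b by lra.
  rewrite -lerBrDl -lerN2 opprB -ln_div ?posrE//.
  rewrite (_ : _ / _ = 1 + - (m%:R + 1 + b)^-1); last by field; rewrite lt0r_neq0.
  by apply: le_ln1Dx; rewrite ltrN2 invf_lt1//; lra.
rewrite e1 ?addrK in IH1 IH2; rewrite e1 e2 addrK; lra.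
Qed.

Lemma cvg_lnV_nat : (ln n%:R)^-1 @[n --> \oo] --> (0 : R).
Proof.
have ln_gt A : \forall n \near \oo, A < ln n%:R :> R.
  near=> n.
  have h : expR A < n%:R by near: n; exact: nbhs_infty_gtr.
  by rewrite -ltr_expR lnK// posrE (lt_trans (expR_gt0 A)).
apply/gtr0_cvgV0; first exact: ln_gt.
by apply/cvgryPgt => A; exact: ln_gt.
Unshelve. all: by end_near. Qed.

Lemma ln_nat_gt0 : \forall n \near \oo, 0 < ln n%:R :> R.
Proof.
near=> n; apply: ln_gt0; near: n; exact: nbhs_infty_gtr.
Unshelve. all: by end_near. Qed.

Lemma cvg_sum_inv_ln b : 0 < b ->
  (\sum_(1 <= k < n) (k%:R + b)^-1) / ln n%:R @[n --> \oo] --> (1 : R).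
Proof.
move=> b0.
have h1 := @cvg_seqZ _ _ (- ln (1 + b)) _ cvg_lnV_nat; rewrite mulr0 in h1.
have h2 := @cvg_seqZ _ _ (ln 2 - ln b) _ cvg_lnV_nat; rewrite mulr0 in h2.
have h3 := @cvg_seqcD _ _ 1 _ h1.
have h4 := @cvg_seqcD _ _ 1 _ h2.
rewrite !addr0 in h3 h4.
apply: (squeeze_cvgr _ h3 h4); near=> n.
have n1 : 1 <= n%:R :> R by near: n; exact: nbhs_infty_ger.
have nb : b <= n%:R by near: n; exact: nbhs_infty_ger.
have n0' : (0 < n)%N by rewrite -(ltr0n R); lra.
have l0 : 0 < ln n%:R :> R by near: n; exact: ln_nat_gt0.
have /andP[s1 s2] := sum_inv_ln b0 n0'.
have s3 : ln n%:R <= ln (n%:R + b) by rewrite ler_ln ?posrE; lra.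
have s4 : ln (n%:R - 1 + b) <= ln 2 + ln n%:R.
  by rewrite -lnM ?posrE//; [rewrite ler_ln ?posrE; lra|lra].
apply/andP; split.
  rewrite ler_pdivlMr// mulrDl mulfVK ?gt_eqF//; lra.
rewrite ler_pdivrMr// mulrDl mulfVK ?gt_eqF//; lra.
Unshelve. all: by end_near. Qed.

(** For [a = b / 2] the harmonic sum makes [critical_moment] dominate
    [rising a n ^+ 2] by a logarithm. *)
Lemma cvg_variance_critical b s : 0 < b < 1 ->
  (critical_moment b n - (2 * s - 1) ^+ 2 * rising (b / 2) n ^+ 2) /
    (n%:R `^ b * ln n%:R) @[n --> \oo] --> (Gamma b)^-1.
Proof.
move=> /andP[b0 b1].
have a1 : -1 < b / 2 by lra. have b1' : -1 < b by lra.
have h1 := cvg_seqM cvg_lnV_nat (cvg_powR_natM (cvg_rising a1) (cvg_rising a1)).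
rewrite mul0r in h1.
have h2 := @cvg_seqZ _ _ ((2 * s - 1) ^+ 2) _ h1; rewrite mulr0 in h2.
have h3 := @cvg_seqD _ _ _ _ _ cvg_lnV_nat (@cvg_seqZ _ _ b _ (cvg_sum_inv_ln b0)).
rewrite add0r mulr1 in h3.
have h := cvg_seqB (cvg_seqM (cvg_rising b1') h3) h2; rewrite subr0 in h.
have g0 : Gamma b != 0 by apply/lt0r_neq0/Gamma_gt0; lra.
rewrite (GammaS b0) invfM mulrAC mulVf ?mul1r in h; last by rewrite gt_eqF.
apply: cvg_near_eq h; near=> n.
have n0 : 0 < n%:R :> R by near: n; exact: nbhs_infty_gtr.
have l0 : 0 < ln n%:R :> R by near: n; exact: ln_nat_gt0.
have q0 : n%:R `^ b != 0 by rewrite gt_eqF// powR_gt0.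
rewrite /critical_moment -mulr_sumr (_ : b / 2 + b / 2 = b); last by field.
by field; rewrite q0 gt_eqF.
Unshelve. all: by end_near. Qed.

End MomentAsymptotics.

(** * Moments of the walk as finite averages *)

Section WalkExpectation.
Context {R : realType}.
Variables (a b s : R).
Implicit Types (h : seq R) (phi psi : seq R -> R).

Definition choices : seq R := [:: 1; -1; 0].

Definition choice_prob (z : R) : R :=
  if z == 1 then (b + a) / 2 else if z == -1 then (b - a) / 2 else 1 - b.

(** Expectation of [phi] at the sequence of the first [n.+1] steps, computed by
    averaging over the remembered time [k] and the selection [z] of each step. *)
Fixpoint walkE (n : nat) phi : R :=
  if n is m.+1 then
    walkE m (fun h => \sum_(k < m.+1) \sum_(z <- choices)
      m.+1%:R^-1 * choice_prob z * phi (rcons h (z * h`_k)))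
  else s * phi [:: 1] + (1 - s) * phi [:: -1].

Definition walk_path n h := (size h == n.+1) && all (mem choices) h.

Lemma mem_choicesM z x : z \in choices -> x \in choices -> z * x \in choices.
Proof.
rewrite !inE => /or3P[]/eqP-> /or3P[]/eqP->;
  by rewrite ?(mul1r, mulN1r, mulr0, mul0r, opprK, oppr0) ?eqxx ?orbT.
Qed.

Lemma sum_choices (F : R -> R) : \sum_(z <- choices) choice_prob z * F z =
  (b + a) / 2 * F 1 + (b - a) / 2 * F (-1) + (1 - b) * F 0.
Proof.
have e1 : (-1 == 1 :> R) = false by apply/eqP; lra.
have e2 : (0 == 1 :> R) = false by apply/eqP; lra.
have e3 : (0 == -1 :> R) = false by apply/eqP; lra.
by rewrite !big_cons big_nil /choice_prob !eqxx e1 e2 e3 addr0 addrA.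
Qed.

Lemma walk_path_rcons n h z (k : 'I_n.+1) : walk_path n h -> z \in choices ->
  walk_path n.+1 (rcons h (z * h`_k)).
Proof.
move=> /andP[/eqP sh ah] zc; rewrite /walk_path size_rcons sh eqxx all_rcons /= ah andbT.
apply: mem_choicesM => //; apply: (allP ah).
by rewrite mem_nth// sh.
Qed.

Lemma eq_walkE n phi psi :
  (forall h, walk_path n h -> phi h = psi h) -> walkE n phi = walkE n psi.
Proof.
elim: n phi psi => [|n IH] phi psi e /=.
  by rewrite !e// /walk_path /= !inE !eqxx ?orbT.
apply: IH => h wh; apply: eq_bigr => k _.
rewrite !big_seq; apply: eq_bigr => z zc; congr (_ * _).
exact/e/walk_path_rcons.
Qed.

Lemma walkE_lin n (c : R) phi psi :
  walkE n (fun h => c * phi h + psi h) = c * walkE n phi + walkE n psi.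
Proof.
elim: n phi psi => [|n IH] phi psi /=; first ring.
rewrite -IH; apply: eq_walkE => h _.
rewrite mulr_sumr -big_split; apply: eq_bigr => k _ /=.
rewrite mulr_sumr -big_split; apply: eq_bigr => z _ /=.
ring.
Qed.

Definition seq_position h : R := \sum_(x <- h) x.

Definition seq_moves h : R := \sum_(x <- h) (x != 0)%:R.

Lemma seq_moves_sqr n h : walk_path n h -> seq_moves h = \sum_(x <- h) x ^+ 2.
Proof.
move=> /andP[_ /allP ah]; apply: eq_big_seq => x /ah; rewrite !inE.
have e1 : (1 != 0 :> R) by apply/eqP; lra.
have e2 : (-1 != 0 :> R) by apply/eqP; lra.
by move=> /or3P[]/eqP->; rewrite ?e1 ?e2 ?eqxx ?sqrrN ?expr1n ?expr0n.
Qed.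

(** If the average of [phi] over the next selection is quadratic in the remembered
    step [x], averaging over the remembered time only involves the sums of the [x]
    and of the [x ^+ 2], which are the position and the number of moves.  Every
    moment recursion below is an instance. *)
Lemma walkES n phi (c0 c1 c2 : seq R -> R) :
  (forall h x, walk_path n h -> x \in choices ->
    (b + a) / 2 * phi (rcons h x) + (b - a) / 2 * phi (rcons h (- x)) +
    (1 - b) * phi (rcons h 0) = c0 h + c1 h * x + c2 h * x ^+ 2) ->
  walkE n.+1 phi =
  walkE n (fun h => c0 h + (c1 h * seq_position h + c2 h * seq_moves h) / n.+1%:R).
Proof.
move=> e /=; apply: eq_walkE => h wh.
have n1 : n.+1%:R != 0 :> R by rewrite pnatr_eq0.
transitivity (\sum_(k < n.+1) n.+1%:R^-1 *
    (c0 h + c1 h * h`_k + c2 h * h`_k ^+ 2)).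
  apply: eq_bigr => k _; under eq_bigr do rewrite -mulrA.
  rewrite -mulr_sumr sum_choices mul1r mulN1r mul0r e//.
  move: wh => /andP[/eqP sh ah]; apply: (allP ah).
  by rewrite mem_nth// sh.
have sh : size h = n.+1 by move: wh => /andP[/eqP].
rewrite -mulr_sumr (seq_moves_sqr wh) /seq_position.
have -> : \sum_(k < n.+1) (c0 h + c1 h * h`_k + c2 h * h`_k ^+ 2) =
    \sum_(x <- h) (c0 h + c1 h * x + c2 h * x ^+ 2).
  by rewrite [RHS](big_nth 0) sh big_mkord.
rewrite !big_split/= -!mulr_sumr big_const_seq count_predT sh iter_addr_0 -mulr_natl.
by field.
Qed.

Lemma seq_position_rcons h x : seq_position (rcons h x) = seq_position h + x.
Proof. by rewrite /seq_position big_rcons/= addrC. Qed.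

Lemma seq_moves_rcons h x : x \in choices ->
  seq_moves (rcons h x) = seq_moves h + x ^+ 2.
Proof.
rewrite /seq_moves big_rcons/= => xc; congr (_ + _).
have := @seq_moves_sqr 0 [:: x]; rewrite /seq_moves !big_seq1; apply.
by rewrite /walk_path /= andbT.
Qed.

Lemma choicesN x : x \in choices -> - x \in choices.
Proof. by move=> xc; rewrite -mulN1r mem_choicesM// !inE eqxx orbT. Qed.

Lemma choices_cube x : x \in choices -> x ^+ 3 = x.
Proof.
by rewrite !inE => /or3P[]/eqP->; rewrite ?expr1n ?expr0n// exprS sqrrN expr1n mulr1.
Qed.

Lemma moves_rconsE h x : x \in choices ->
  [/\ seq_moves (rcons h x) = seq_moves h + x ^+ 2,
      seq_moves (rcons h (- x)) = seq_moves h + x ^+ 2 &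
      seq_moves (rcons h 0) = seq_moves h].
Proof.
move=> xc; rewrite !seq_moves_rcons ?choicesN ?sqrrN ?expr0n ?addr0//.
by rewrite !inE eqxx !orbT.
Qed.

Lemma walkEZ n (c : R) phi : walkE n (fun h => c * phi h) = c * walkE n phi.
Proof.
elim: n phi => [|n IH] phi /=; first ring.
rewrite -IH; apply: eq_walkE => h _.
rewrite mulr_sumr; apply: eq_bigr => k _.
by rewrite mulr_sumr; apply: eq_bigr => z _; ring.
Qed.

Lemma walkE1 n : walkE n (fun=> 1) = 1.
Proof.
elim: n => [|n IH]; first by rewrite /=; ring.
rewrite (@walkES _ _ (fun=> 1) (fun=> 0) (fun=> 0)); last by move=> *; field.
by rewrite -[RHS]IH; apply: eq_walkE => h _; ring.
Qed.

Lemma walkE_position n : walkE n seq_position = (2 * s - 1) * rising a n.+1.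
Proof.
elim: n => [|n IH]; first by rewrite /= rising1 /seq_position !big_seq1; ring.
rewrite (@walkES _ _ seq_position (fun=> a) (fun=> 0)); last first.
  by move=> h x _ _; rewrite !seq_position_rcons; field.
rewrite (@eq_walkE _ _ (fun h => a / n.+1%:R * seq_position h + seq_position h)).
  by rewrite walkE_lin IH [in RHS]risingS//; ring.
by move=> h _; ring.
Qed.

Lemma walkE_moves n : walkE n seq_moves = rising b n.+1.
Proof.
have e1 : (1 != 0 :> R) by apply/eqP; lra.
have e2 : (-1 != 0 :> R) by apply/eqP; lra.
elim: n => [|n IH].
  by rewrite /= rising1 /seq_moves !big_seq1 e1 e2 /=; ring.
rewrite (@walkES _ _ seq_moves (fun=> 0) (fun=> b)); last first.
  by move=> h x _ /moves_rconsE-/(_ h)[-> -> ->]; field.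
rewrite (@eq_walkE _ _ (fun h => b / n.+1%:R * seq_moves h + seq_moves h)).
  by rewrite walkE_lin IH [in RHS]risingS//; ring.
by move=> h _; ring.
Qed.

(** The recursion [w (n + 1) = w n * (1 + 2 b / n) + (b / n) * rising b n] has the
    particular solution [- rising b n]. *)
Lemma walkE_moves2 n : walkE n (fun h => seq_moves h ^+ 2) =
  2 * rising (2 * b) n.+1 - rising b n.+1.
Proof.
have e1 : (1 != 0 :> R) by apply/eqP; lra.
have e2 : (-1 != 0 :> R) by apply/eqP; lra.
elim: n => [|n IH].
  by rewrite /= !rising1 /seq_moves !big_seq1 e1 e2 /=; ring.
rewrite (@walkES _ _ (fun h => seq_moves h ^+ 2) (fun=> 0)
  (fun h => 2 * b * seq_moves h + b)); last first.
  move=> h x _ xc; have x3 := choices_cube xc.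
  have x4 : x ^+ 4 = x ^+ 2 by rewrite [LHS]exprS x3 -expr2.
  have [-> -> ->] := moves_rconsE h xc.
  transitivity (seq_moves h ^+ 2 + 2 * b * seq_moves h * x ^+ 2 + b * x ^+ 4).
    by field.
  by rewrite x4; ring.
rewrite (@eq_walkE _ _ (fun h => (2 * b / n.+1%:R) * seq_moves h ^+ 2 +
   (b / n.+1%:R * seq_moves h + seq_moves h ^+ 2))); last by move=> h _; ring.
rewrite !walkE_lin IH walkE_moves !(risingS _ (ltn0Sn n)); field.
by rewrite lt0r_neq0// ltr_wpDr.
Qed.

(** The mixed moment uses [x ^+ 3 = x]; the recursion has a multiple of
    [rising a n] as particular solution. *)
Lemma walkE_position_moves n : b != 0 ->
  walkE n (fun h => seq_position h * seq_moves h) =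
  (2 * s - 1) * ((a + b) / b * rising (a + b) n.+1 - a / b * rising a n.+1).
Proof.
move=> b0.
have e1 : (1 != 0 :> R) by apply/eqP; lra.
have e2 : (-1 != 0 :> R) by apply/eqP; lra.
elim: n => [|n IH].
  by rewrite /= !rising1 /seq_moves /seq_position !big_seq1 e1 e2 /=; field.
rewrite (@walkES _ _ (fun h => seq_position h * seq_moves h)
  (fun h => a * seq_moves h + a) (fun h => b * seq_position h)); last first.
  move=> h x _ xc; have x3 := choices_cube xc.
  have [-> -> ->] := moves_rconsE h xc.
  rewrite !seq_position_rcons.
  transitivity (seq_position h * seq_moves h + a * seq_moves h * x +
    b * seq_position h * x ^+ 2 + a * x ^+ 3); first by field.
  by rewrite x3; ring.
rewrite (@eq_walkE _ _ (fun h => ((a + b) / n.+1%:R) * (seq_position h * seq_moves h) +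
   (a / n.+1%:R * seq_position h + seq_position h * seq_moves h))); last by move=> h _; ring.
rewrite !walkE_lin IH walkE_position !(risingS _ (ltn0Sn n)); field.
by rewrite b0 lt0r_neq0// ltr_wpDr.
Qed.

Lemma walkE_position2S n : walkE n.+1 (fun h => seq_position h ^+ 2) =
  (1 + 2 * a / n.+1%:R) * walkE n (fun h => seq_position h ^+ 2) +
  b / n.+1%:R * rising b n.+1.
Proof.
rewrite (@walkES _ _ (fun h => seq_position h ^+ 2)
  (fun h => 2 * a * seq_position h) (fun => b)); last first.
  by move=> h x _ xc; rewrite !seq_position_rcons; field.
rewrite (@eq_walkE _ _ (fun h => (1 + 2 * a / n.+1%:R) * (seq_position h ^+ 2) +
   b / n.+1%:R * seq_moves h)); last by move=> h _; ring.
by rewrite walkE_lin walkEZ walkE_moves.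
Qed.

Lemma walkE_position2_0 : walkE 0 (fun h => seq_position h ^+ 2) = 1.
Proof. by rewrite /= /seq_position !big_seq1 sqrrN expr1n; ring. Qed.

Lemma walkE_position2 n : b != 2 * a ->
  walkE n (fun h => seq_position h ^+ 2) = square_moment a b n.+1.
Proof.
move=> ab; have d : b - 2 * a != 0 by rewrite subr_eq0.
elim: n => [|n IH].
  by rewrite walkE_position2_0 /square_moment !rising1; field.
rewrite walkE_position2S IH /square_moment !(risingS _ (ltn0Sn n)); field.
by rewrite d lt0r_neq0// ltr_wpDr.
Qed.

Lemma walkE_position2_critical n : 0 < b -> b = 2 * a ->
  walkE n (fun h => seq_position h ^+ 2) = critical_moment b n.+1.
Proof.
move=> b0 ab; rewrite /critical_moment; elim: n => [|n IH].
  by rewrite walkE_position2_0 rising1 big_geq// addr0 mul1r.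
rewrite walkE_position2S IH -ab [in RHS]risingS// [X in _ = _ * (1 + X)]big_nat_recr//=.
set S := \sum_(_ <= _ < _) _.
have n0 : 0 <= n%:R :> R by [].
by field; rewrite !lt0r_neq0//; lra.
Qed.

End WalkExpectation.

(** * From independence to finite averages *)

Section Representation.
Context {R : realType} {d : measure_display} {T : measurableType d}.
Variable P : probability T R.

(** The complement of the finitely many fibres of full total mass is negligible. *)
Lemma ae_mem_support (I : eqType) (Y : T -> I) (l : seq I) : uniq l ->
  (forall x, measurable (Y @^-1` [set x])) ->
  (\sum_(x <- l) P (Y @^-1` [set x]) = 1)%E ->
  {ae P, forall w, Y w \in l}.
Proof.
move=> ul mY sum1.
have key : forall l, uniq l -> measurable [set w | Y w \in l] /\
    (P [set w | Y w \in l] = \sum_(x <- l) P (Y @^-1` [set x]))%E.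
  elim=> [_|x {ul sum1}l IH /= /andP[xl /IH[ml Pl]]].
    rewrite big_nil (_ : [set w | _] = set0) ?measure0//.
    by apply/seteqP; split.
  have e : [set w | Y w \in x :: l] = Y @^-1` [set x] `|` [set w | Y w \in l].
    apply/seteqP; split=> w /=; rewrite inE.
      by move=> /orP[/eqP|]; [left|right].
    by move=> [->|->]; rewrite ?eqxx ?orbT.
  rewrite e; split; first exact: measurableU.
  rewrite big_cons -Pl measureU//.
  by apply/seteqP; split=> w //= -[-> lx]; rewrite lx in xl.
have [ml Pl] := key l ul.
exists (~` [set w | Y w \in l]); split => //; first exact: measurableC.
rewrite probability_setC// Pl sum1.
by rewrite subee.
Qed.

Variables (X1 : {RV P >-> R}) (U : nat -> {RV P >-> nat}) (xi : nat -> {RV P >-> R}).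
Let F := erws_sigma X1 U xi.
Hypothesis indep : mutually_independent P F.

Lemma erws_sigma_measurable i A : F i A -> measurable A.
Proof.
by case: i => [[n|n]|] [B mB <-]; exact: measurable_funPT.
Qed.

(** Indices of the first step and of the choices made for the next [n] steps. *)
Fixpoint past (n : nat) : {fset option (nat + nat)} :=
  if n is m.+1 then (Some (inl m) |` (Some (inr m) |` past m))%fset
  else [fset None]%fset.

Lemma notin_past n k : (n <= k)%N ->
  (Some (inl k) \notin past n) && (Some (inr k) \notin past n).
Proof.
elim: n => [|n IH] nk /=; first by rewrite !inE.
have /andP[h1 h2] := IH (ltnW nk).
rewrite !inE !negb_or h1 h2 !andbT /=.
by apply/andP; split; apply/eqP => -[e]; rewrite e ltnn in nk.
Qed.

(** A cylinder over the indices [past n]. *)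
Definition past_event n (C : set T) := exists2 E : option (nat + nat) -> set T,
  (forall i, i \in past n -> F i (E i)) & C = \bigcap_(i in [set` past n]) E i.

Lemma measurable_past_event n C : past_event n C -> measurable C.
Proof.
move=> [E FE ->]; apply: fin_bigcap_measurable => // i /= /FE.
exact: erws_sigma_measurable.
Qed.

(** The indices of the next choice are fresh, so the product rule over [past n.+1]
    splits off two factors. *)
Lemma past_eventI n C A B : past_event n C ->
  F (Some (inl n)) A -> F (Some (inr n)) B ->
  past_event n.+1 (C `&` (A `&` B)) /\
  (P (C `&` (A `&` B)) = P C * (P A * P B))%E.
Proof.
move=> [E FE ->] FA FB.
pose E' (i : option (nat + nat)) := match i with
  | Some (inl m) => if m == n then A else E i
  | Some (inr m) => if m == n then B else E i
  | None => E i end.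
have /andP[nl nr] := notin_past (leqnn n).
have E'E i : i \in past n -> E' i = E i.
  case: i => [[m|m]|]//= mi; case: eqP => // mn; move: mi; rewrite mn.
    by rewrite (negbTE nl).
  by rewrite (negbTE nr).
have FE' i : i \in past n.+1 -> F i (E' i).
  rewrite /= !inE => /orP[/eqP->|/orP[/eqP->|ip]].
  - by rewrite /E' eqxx.
  - by rewrite /E' eqxx.
  - by rewrite E'E//; exact: FE.
have e : \bigcap_(i in [set` past n]) E i `&` (A `&` B) = \bigcap_(i in [set` past n.+1]) E' i.
  apply/seteqP; split=> w.
    move=> [Ew [Aw Bw]] i /=; rewrite !inE => /orP[/eqP->|/orP[/eqP->|ip]].
    - by rewrite /= eqxx.
    - by rewrite /= eqxx.
    - by rewrite E'E//; exact: Ew.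
  move=> E'w; split; first by move=> i ip; rewrite -E'E//; apply: E'w; rewrite /= !inE ip !orbT.
  split.
    by have := E'w (Some (inl n)); rewrite /= !inE !eqxx; exact.
  by have := E'w (Some (inr n)); rewrite /= !inE !eqxx orbT; exact.
split; first by exists E'.
rewrite e (indep FE') (indep FE).
rewrite big_fsetU1/=; last by rewrite !inE negb_or nl andbT.
rewrite big_fsetU1//= !eqxx muleA muleC; congr (_ * _)%E.
by apply: eq_big_seq => i /E'E ->.
Qed.

(** [rep n G v]: up to a null set, [G] is a combination of indicators of cylinders
    over [past n], and [v] is the same combination of their probabilities.
    Closing under almost sure equality allows functions [G] that are not
    measurable, such as arbitrary functions of the path: the steps take their
    three values only almost surely. *)
Inductive rep (n : nat) : (T -> R) -> R -> Prop :=
| rep_zero : rep n (fun=> 0) 0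
| rep_indic C : past_event n C -> rep n \1_C (fine (P C))
| rep_add G v G' v' : rep n G v -> rep n G' v' -> rep n (fun w => G w + G' w) (v + v')
| rep_scale c G v : rep n G v -> rep n (fun w => c * G w) (c * v)
| rep_ae G G' v : {ae P, forall w, G w = G' w} -> rep n G v -> rep n G' v.

Lemma rep_sum (I : eqType) (r : seq I) n (G : I -> T -> R) (v : I -> R) :
  (forall i, i \in r -> rep n (G i) (v i)) ->
  rep n (fun w => \sum_(i <- r) G i w) (\sum_(i <- r) v i).
Proof.
elim: r => [|i r IH] h.
  rewrite big_nil (_ : (fun _ => _) = fun=> 0); first exact: rep_zero.
  by apply/funext => w; rewrite big_nil.
rewrite big_cons (_ : (fun _ => _) = fun w => G i w + \sum_(j <- r) G j w).
  apply: rep_add; first by apply: h; rewrite mem_head.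
  by apply: IH => j jr; apply: h; rewrite inE jr orbT.
by apply/funext => w; rewrite big_cons.
Qed.

(** Independence of the past and of the next choice. *)
Lemma repM n G v A B : rep n G v ->
  F (Some (inl n)) A -> F (Some (inr n)) B ->
  rep n.+1 (fun w => G w * (\1_A w * \1_B w)) (v * (fine (P A) * fine (P B))).
Proof.
(* Linearity reduces the claim to one cylinder, where it is the product rule. *)
move=> r FA FB; elim: r => {G v} [|C pC|G v G' v' _ IH _ IH'|c G v _ IH|G G' v ae _ IH].
- rewrite mul0r (_ : (fun _ => _) = fun=> 0); first exact: rep_zero.
  by apply/funext => w; rewrite mul0r.
- have [pC' PC'] := past_eventI pC FA FB.
  have mA := erws_sigma_measurable FA. have mB := erws_sigma_measurable FB.
  have mC := measurable_past_event pC.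
  have -> : fine (P C) * (fine (P A) * fine (P B)) = fine (P (C `&` (A `&` B))).
    by rewrite PC' !fineM ?fin_numM ?fin_num_measure.
  rewrite (_ : (fun _ => _) = \1_(C `&` (A `&` B))); first exact: rep_indic.
  by apply/funext => w; rewrite !indicI.
- rewrite mulrDl (_ : (fun _ => _) = fun w => G w * (\1_A w * \1_B w) + G' w * (\1_A w * \1_B w)).
    exact: rep_add.
  by apply/funext => w; rewrite mulrDl.
- rewrite -mulrA (_ : (fun _ => _) = fun w => c * (G w * (\1_A w * \1_B w))).
    exact: rep_scale.
  by apply/funext => w; rewrite mulrA.
- apply: rep_ae IH; apply: filterS ae => w e; by rewrite e.
Qed.

Lemma rep_expectation n G v : rep n G v -> measurable_fun setT G ->
  ('E_P[G] = v%:E)%E.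
Proof.
move=> r mG.
suff [G' [iG' e ae]] : exists G' : T -> R, [/\ P.-integrable setT (EFin \o G'),
    (\int[P]_w (G' w)%:E = v%:E)%E & {ae P, forall w, G' w = G w}].
  rewrite unlock -e; apply: ae_eq_integral => //.
  - exact/measurable_EFinP.
  - by have /integrableP[] := iG'.
  - by apply: filterS ae => w -> _.
elim: r {mG} => {G v} [|C pC|G v G' v' _ [H [iH e ae]] _ [H' [iH' e' ae']]|
    c G v _ [H [iH e ae]]|G G' v ae' _ [H [iH e ae]]].
- exists (fun=> 0); split; first exact: integrable0.
    by rewrite integral0.
  exact: aeW.
- have mC := measurable_past_event pC.
  exists \1_C; split; last exact: aeW.
    exact: integrable_indic.
  by rewrite integral_indic// setIT fineK// fin_num_measure.
- exists (fun w => H w + H' w); split.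
  + have h := integrableD measurableT iH iH'.
    by apply: eq_integrable h => // w _; rewrite /= EFinD.
  + by under eq_integral do rewrite EFinD; rewrite integralD// e e'.
  + by apply: filterS2 ae ae' => w -> ->.
- exists (fun w => c * H w); split.
  + have h := integrableZl measurableT c iH.
    by apply: eq_integrable h => // w _; rewrite /= EFinM.
  + by under eq_integral do rewrite EFinM; rewrite integralZl// e.
  + by apply: filterS ae => w ->.
- exists H; split => //.
  by apply: filterS2 ae ae' => w -> ->.
Qed.

End Representation.

Section WalkLaw.
Context {R : realType} {d : measure_display} {T : measurableType d}.
Variable P : probability T R.
Variables (a b s : R) (X : nat -> {RV P >-> R}).

Lemma walkE_sum (I : Type) (r : seq I) n (G : I -> seq R -> R) :
  walkE a b s n (fun h => \sum_(i <- r) G i h) = \sum_(i <- r) walkE a b s n (G i).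
Proof.
elim: r => [|i r IH].
  rewrite big_nil -[RHS](mul0r (walkE a b s n (fun=> 1))) -walkEZ.
  by apply: eq_walkE => h _; rewrite big_nil mul0r.
rewrite big_cons -IH -[walkE _ _ _ _ (G i)]mul1r -walkE_lin.
by apply: eq_walkE => h _; rewrite big_cons mul1r.
Qed.

Definition steps n w : seq R := [seq X i w | i <- iota 1 n.+1].

Lemma stepsS n w : steps n.+1 w = rcons (steps n w) (X n.+2 w).
Proof. by rewrite /steps -[in LHS](addn1 n.+1) iotaD map_cat /= cats1 add1n. Qed.

Lemma nth_steps n w (k : 'I_n.+1) : (steps n w)`_k = X k.+1 w.
Proof. by rewrite (nth_map 0%N) ?size_iota// nth_iota// add1n. Qed.

Variables (U : nat -> {RV P >-> nat}) (xi : nat -> {RV P >-> R}).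
Hypotheses (PX1 : P (X 1%N @^-1` [set 1]) = s%:E)
  (PX1N : P (X 1%N @^-1` [set -1]) = (1 - s)%:E)
  (PU : forall n k, (1 <= k <= n)%N -> P (U n @^-1` [set k]) = (n%:R^-1)%:E)
  (Pxi : forall n, (1 <= n)%N ->
          [/\ P (xi n @^-1` [set 1]) = ((b + a) / 2)%:E,
              P (xi n @^-1` [set -1]) = ((b - a) / 2)%:E &
              P (xi n @^-1` [set 0]) = (1 - b)%:E])
  (indep : mutually_independent P (erws_sigma (X 1%N) U xi))
  (recX : forall n, (1 <= n)%N ->
          {ae P, forall w, X n.+1 w = xi n w * X (U n w) w}).

Lemma measurable_fiber (Y : {RV P >-> R}) (x : R) : measurable (Y @^-1` [set x]).
Proof. exact: measurable_funPTI. Qed.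

Let F := erws_sigma (X 1%N) U xi.

Lemma uniq_choices : uniq (choices : seq R).
Proof.
have e1 : (1 == -1 :> R) = false by apply/eqP; lra.
have e2 : (1 == 0 :> R) = false by apply/eqP; lra.
have e3 : (-1 == 0 :> R) = false by apply/eqP; lra.
by rewrite /= !inE e1 e2 e3.
Qed.

Lemma ae_X1 : {ae P, forall w, X 1%N w \in [:: 1; -1]}.
Proof.
apply: ae_mem_support.
- have e1 : (1 == -1 :> R) = false by apply/eqP; lra.
  by rewrite /= !inE e1.
- move=> x; exact: measurable_fiber.
- by rewrite !big_cons big_nil PX1 PX1N adde0 -EFinD addrC subrK.
Qed.

Lemma ae_U n : {ae P, forall w, U n.+1 w \in iota 1 n.+1}.
Proof.
apply: ae_mem_support.
- exact: iota_uniq.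
- by move=> x; exact: measurable_funPTI.
- rewrite (eq_big_seq (fun=> (n.+1%:R^-1)%:E)); last first.
    by move=> k; rewrite mem_iota add1n ltnS => /PU.
  rewrite sumEFin big_const_seq count_predT size_iota iter_addr_0 -[_ *+ _]mulr_natr.
  by rewrite mulVf// pnatr_eq0.
Qed.

Lemma ae_xi n : {ae P, forall w, xi n.+1 w \in (choices : seq R)}.
Proof.
have [p1 p2 p3] := Pxi (ltn0Sn n).
apply: ae_mem_support.
- exact: uniq_choices.
- move=> x; exact: measurable_fiber.
- have e : (b + a) / 2 + ((b - a) / 2 + (1 - b)) = 1 by field.
  by rewrite !big_cons big_nil p1 p2 p3 adde0 -!EFinD e.
Qed.

Lemma choice_probE n z : z \in (choices : seq R) ->
  fine (P (xi n.+1 @^-1` [set z])) = choice_prob a b z.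
Proof.
have [p1 p2 p3] := Pxi (ltn0Sn n).
have e2 : (0 == 1 :> R) = false by apply/eqP; lra.
have e3 : (-1 == 1 :> R) = false by apply/eqP; lra.
have e4 : (0 == -1 :> R) = false by apply/eqP; lra.
by rewrite !inE /choice_prob => /or3P[]/eqP->; rewrite ?eqxx ?e2 ?e3 ?e4 ?p1 ?p2 ?p3.
Qed.

Lemma sum_indic (I : eqType) (r : seq I) (x : I) (G : I -> R) : uniq r -> x \in r ->
  \sum_(i <- r) G i * (x == i)%:R = G x.
Proof.
move=> ur xr; rewrite (bigD1_seq x)//= eqxx mulr1 big1 ?addr0// => i ix.
by rewrite eq_sym (negbTE ix) mulr0.
Qed.

Lemma indic_fiber (I : eqType) (Y : T -> I) (x : I) w :
  \1_(Y @^-1` [set x]) w = (Y w == x)%:R :> R.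
Proof.
rewrite indicE; congr (_%:R); congr nat_of_bool.
by apply/idP/eqP; rewrite inE.
Qed.

(** The function of the first [n.+2] steps is split according to the values [k.+1]
    of the next remembered time and [z] of the next selection; on each piece it is
    a function of the first [n.+1] steps. *)
Lemma rep_steps n phi :
  rep (X 1%N) U xi n (fun w => phi (steps n w)) (walkE a b s n phi).
Proof.
elim: n phi => [|n IH] phi.
  have pe x : past_event (X 1%N) U xi 0 (X 1%N @^-1` [set x]).
    exists (fun=> X 1%N @^-1` [set x]).
      move=> i; rewrite /= inE => /eqP->; exists [set x] => //.
      by rewrite setTI.
    by apply/seteqP; split=> w /= => [h i _//|]; apply; rewrite /= inE.
  have := rep_add (rep_scale (phi [:: 1]) (rep_indic (pe 1)))
                  (rep_scale (phi [:: -1]) (rep_indic (pe (-1)))).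
  rewrite PX1 PX1N /= [phi [:: 1] * s]mulrC [phi [:: -1] * _]mulrC.
  apply: rep_ae; apply: filterS ae_X1 => w.
  have e1 : (1 == -1 :> R) = false by apply/eqP; lra.
  have e2 : (-1 == 1 :> R) = false by apply/eqP; lra.
  rewrite !indic_fiber /steps /= !inE => /orP[]/eqP->; rewrite eqxx ?e1 ?e2/=; ring.
pose psi (k : 'I_n.+1) z h := phi (rcons h (z * h`_k)).
have step (k : 'I_n.+1) z : z \in (choices : seq R) ->
  rep (X 1%N) U xi n.+1 (fun w => psi k z (steps n w) *
     ((U n.+1 w == k.+1)%:R * (xi n.+1 w == z)%:R))
   (n.+1%:R^-1 * choice_prob a b z * walkE a b s n (psi k z)).
  move=> zc; have FA : F (Some (inl n)) (U n.+1 @^-1` [set k.+1]).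
    by exists [set k.+1] => //; rewrite setTI.
  have FB : F (Some (inr n)) (xi n.+1 @^-1` [set z]).
    by exists [set z] => //; rewrite setTI.
  have := repM indep (IH (psi k z)) FA FB.
  rewrite choice_probE// PU /=; last by rewrite ltn_ord.
  rewrite [walkE _ _ _ _ _ * _]mulrC.
  by apply: rep_ae; apply: aeW => w; rewrite !indic_fiber.
have : rep (X 1%N) U xi n.+1 (fun w => \sum_(k < n.+1) \sum_(z <- choices)
    psi k z (steps n w) * ((U n.+1 w == k.+1)%:R * (xi n.+1 w == z)%:R))
    (walkE a b s n.+1 phi).
  rewrite /= walkE_sum; apply: rep_sum => k _.
  rewrite walkE_sum; apply: rep_sum => z zc.
  by rewrite walkEZ; exact: step.
apply: rep_ae; apply: filterS3 (ae_U n) (ae_xi n) (recX (ltn0Sn n)) => w uw xw rw.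
under eq_bigr => k _.
  under eq_bigr do rewrite mulrA.
  rewrite (sum_indic (fun z => psi k z (steps n w) * (U n.+1 w == k.+1)%:R) uniq_choices xw).
  over.
have k0P : ((U n.+1 w).-1 < n.+1)%N.
  by move: uw; rewrite mem_iota add1n => /andP[h1 h2]; rewrite prednK.
pose k0 := Ordinal k0P.
have Uk0 : U n.+1 w = k0.+1.
  by move: uw; rewrite mem_iota => /andP[h1 _]; rewrite /k0 /= prednK.
under eq_bigr => k _.
  rewrite Uk0 eqSS (_ : (k0 == k :> nat) = (k0 == k)); last by [].
  over.
rewrite (sum_indic (fun k => psi k (xi n.+1 w) (steps n w)) (index_enum_uniq _) (mem_index_enum k0)).
by rewrite /psi stepsS rw nth_steps Uk0.
Qed.

Lemma positionE n w : position X n.+1 w = seq_position (steps n w).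
Proof. by rewrite /position /seq_position /steps big_map /index_iota subn1. Qed.

Lemma movesE n w : moves X n.+1 w = seq_moves (steps n w).
Proof. by rewrite /moves /seq_moves /steps big_map /index_iota subn1. Qed.

Lemma measurable_position n : measurable_fun setT (position X n).
Proof. by apply: measurable_sum => i; exact: measurable_funPT. Qed.

Lemma measurable_moves n : measurable_fun setT (moves X n).
Proof.
apply: measurable_sum => i.
rewrite (_ : (fun _ => _) = \1_(~` (X i @^-1` [set 0]))).
  by apply: measurable_indic; apply: measurableC; exact: measurable_fiber.
apply/funext => w; rewrite indicE; congr (_%:R); congr nat_of_bool.
by apply/idP/idP; rewrite inE/= => /eqP.
Qed.

Lemma expectation_steps n (Y : T -> R) phi : measurable_fun setT Y ->
  (forall w, Y w = phi (steps n w)) -> ('E_P[Y] = (walkE a b s n phi)%:E)%E.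
Proof.
move=> mY Yphi; apply: (rep_expectation (n := n) _ mY).
by apply: rep_ae (rep_steps n phi); exact: aeW.
Qed.

(** The product of two centred functions of the path is again a function of the
    path, so no integrability has to be discussed. *)
Lemma covariance_steps n (Y Z : T -> R) phi psi :
  measurable_fun setT Y -> measurable_fun setT Z ->
  (forall w, Y w = phi (steps n w)) -> (forall w, Z w = psi (steps n w)) ->
  covariance P Y Z = (walkE a b s n (fun h => phi h * psi h) -
    walkE a b s n phi * walkE a b s n psi)%:E.
Proof.
move=> mY mZ Yphi Zpsi.
rewrite unlock (expectation_steps mY Yphi) (expectation_steps mZ Zpsi) /=.
set mu := walkE a b s n phi; set nu := walkE a b s n psi.
rewrite (@expectation_steps n _ (fun h => (phi h - mu) * (psi h - nu))).
- rewrite (@eq_walkE _ _ _ _ _ _ (fun h => (- mu) * psi h + ((- nu) * phi h +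
     (mu * nu * 1 + phi h * psi h)))); last by move=> h _; ring.
  rewrite !walkE_lin walkE1 -/mu -/nu; congr (_%:E); ring.
- apply: measurable_funM; exact: measurable_funB.
- by move=> w; rewrite -Yphi -Zpsi.
Qed.

Lemma correlation_erws n : b != 0 ->
  correlation P (position X n.+1) (moves X n.+1) =
  (2 * s - 1) * cov_moves a b n.+1 /
  (Num.sqrt (walkE a b s n (fun h => seq_position h ^+ 2) -
     (2 * s - 1) ^+ 2 * rising a n.+1 ^+ 2) * Num.sqrt (cov_moves b b n.+1)).
Proof.
move=> b0.
have mS := measurable_position n.+1; have mV := measurable_moves n.+1.
have eS := positionE n; have eV := movesE n.
have cSV := covariance_steps mS mV eS eV.
have cSS := covariance_steps mS mS eS eS.
have cVV := covariance_steps mV mV eV eV.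
have vS : fine 'V_P[position X n.+1] =
  walkE a b s n (fun h => seq_position h ^+ 2) - (2 * s - 1) ^+ 2 * rising a n.+1 ^+ 2.
  rewrite /variance cSS /= walkE_position; congr (_ - _); ring.
have vV : fine 'V_P[moves X n.+1] = cov_moves b b n.+1.
  rewrite /variance cVV /= walkE_moves walkE_moves2 /cov_moves.
  rewrite (_ : b + b = 2 * b); last ring.
  by field.
have cE : fine (covariance P (position X n.+1) (moves X n.+1)) =
    (2 * s - 1) * cov_moves a b n.+1.
  rewrite cSV /= walkE_position_moves// walkE_position walkE_moves /cov_moves; ring.
rewrite /correlation -cE -vS -vV.
(* A zero variance makes the quotient zero as well, in agreement with the
   convention, because division by 0 yields 0. *)
by case: ifPn => // /orP[] /eqP->; rewrite /= sqrtr0 ?mul0r ?mulr0 invr0 mulr0.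
Qed.

End WalkLaw.

(** * Signs of the constants *)

Section Constants.
Context {R : realType}.
Implicit Types a b s : R.

Lemma aBeta_gt1 a b : 0 < a -> a < 1 -> 0 < b -> b < 1 -> 1 < a * Beta a b.
Proof.
move=> a0 a1 b0 b1; rewrite (Beta_recl a0 b0).
apply: Beta_product_gt1 => //; lra.
Qed.

Lemma sqrt_aBeta_gt0 a b : 0 < a -> a < 1 -> 0 < b -> b < 1 ->
  0 < Num.sqrt (a * Beta a b - 1).
Proof. by move=> *; rewrite sqrtr_gt0 subr_gt0 aBeta_gt1. Qed.

Lemma Pconst_factors_gt0 a b : 0 < b < 1 -> - b <= a -> a < b / 2 ->
  0 < Num.sqrt ((b - 2 * a) * Gamma b) /\
  0 < Gamma (a + 1) * Num.sqrt (b * Beta b b - 1).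
Proof.
move=> /andP[b0 b1] ba ab; split.
  by rewrite sqrtr_gt0; apply: mulr_gt0; [lra|exact: Gamma_gt0].
by apply: mulr_gt0; [apply: Gamma_gt0; lra|exact: sqrt_aBeta_gt0].
Qed.

Lemma Pconst_gt0 a b : 0 < b < 1 -> 0 < a < b / 2 -> 0 < Pconst a b.
Proof.
move=> b01 /andP[a0 ab]; have /andP[b0 b1] := b01.
have ba : - b <= a by lra.
have [h1 h2] := Pconst_factors_gt0 b01 ba ab.
apply: divr_gt0 (mulr_gt0 h1 _) h2; rewrite subr_gt0.
apply: Beta_product_gt1 => //; lra.
Qed.

Lemma Pconst_lt0 a b : 0 < b < 1 -> - b <= a -> a < 0 -> Pconst a b < 0.
Proof.
move=> b01 ba a0; have /andP[b0 b1] := b01.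
have ab : a < b / 2 by lra.
have [h1 h2] := Pconst_factors_gt0 b01 ba ab.
rewrite /Pconst pmulr_llt0 ?invr_gt0// pmulr_rlt0// subr_lt0.
apply: Beta_product_lt1 => //; lra.
Qed.

Lemma Qconst_gt0 a : 0 < 2 * a -> 2 * a < 1 -> 0 < Qconst a.
Proof.
move=> a0 a1; have a0' : 0 < a by lra. have a1' : a < 1 by lra.
have h1 : 0 < Num.sqrt (Gamma (2 * a)) by rewrite sqrtr_gt0; exact: Gamma_gt0.
have h2 : 0 < a * Beta a (2 * a) - 1 by rewrite subr_gt0; exact: aBeta_gt1.
have h3 : 0 < Gamma (a + 1) by apply: Gamma_gt0; lra.
exact: divr_gt0 (mulr_gt0 h1 h2) (mulr_gt0 h3 (sqrt_aBeta_gt0 a0 a1 a0 a1)).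
Qed.

(** [a ^+ 2 * Beta a a] exceeds [a], which is at least [2 * a - b]. *)
Lemma variance_const_gt0 a b s : 0 < b < 1 -> 0 <= s <= 1 -> b / 2 < a <= b ->
  0 < a ^+ 2 * Beta a a - (2 * s - 1) ^+ 2 * (2 * a - b).
Proof.
move=> /andP[b0 b1] /andP[s0 s1] /andP[ba ab].
have haa : 1 < a * Beta a a by apply: aBeta_gt1; lra.
have a0 : 0 < a by lra.
have h1 : a < a ^+ 2 * Beta a a by rewrite expr2 -mulrA ltr_pMr.
have h2 : (2 * s - 1) ^+ 2 <= 1 by nra.
have h3 : (2 * s - 1) ^+ 2 * (2 * a - b) <= 2 * a - b.
  by rewrite ler_piMl//; lra.
move: (_ * Beta a a) (_ * (2 * a - b)) h1 h3 => x y; lra.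
Qed.

Lemma Rconst_gt0 a b s : 0 < b < 1 -> 0 <= s <= 1 -> b / 2 < a <= b ->
  0 < Rconst a b s.
Proof.
move=> b01 s01 ab; have hv := variance_const_gt0 b01 s01 ab.
move: b01 ab => /andP[b0 b1] /andP[ba ab].
have a0 : 0 < a by lra. have a1 : a < 1 by lra.
have h1 : 0 < Num.sqrt (2 * a - b) by rewrite sqrtr_gt0; lra.
have h2 : 0 < a * Beta a b - 1 by rewrite subr_gt0; exact: aBeta_gt1.
have h3 : 0 < b * Beta b b - 1 by rewrite subr_gt0; exact: aBeta_gt1.
apply: divr_gt0 (mulr_gt0 h1 h2) _; rewrite sqrtr_gt0; exact: mulr_gt0 hv h3.
Qed.

End Constants.

(** * The correlation coefficient *)

Section Assembly.
Context {R : realType}.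

(** Covariance and variances of orders [phi], [mu] and [nu] give a correlation of
    order [phi] over the square root of [mu * nu]. *)
Lemma asymptotic_quotient (f v w phi mu nu : nat -> R) (alpha beta gamma : R) :
  alpha != 0 -> 0 < beta -> 0 < gamma ->
  (\forall n \near \oo, [/\ 0 < phi n, 0 < mu n & 0 < nu n]) ->
  f n / phi n @[n --> \oo] --> alpha ->
  v n / mu n @[n --> \oo] --> beta ->
  w n / nu n @[n --> \oo] --> gamma ->
  (f n / (Num.sqrt (v n) * Num.sqrt (w n))) /
  (alpha / (Num.sqrt beta * Num.sqrt gamma) *
   (phi n / (Num.sqrt (mu n) * Num.sqrt (nu n)))) @[n --> \oo] --> (1 : R).
Proof.
move=> a0 b0 g0 pos cf cv cw.
have csqrt (u : nat -> R) l : u n @[n --> \oo] --> l ->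
    Num.sqrt (u n) @[n --> \oo] --> Num.sqrt l.
  by move=> ul; apply: continuous_cvg => //; exact: sqrt_continuous.
have sb : Num.sqrt beta != 0 by rewrite sqrtr_eq0 -ltNge.
have sg : Num.sqrt gamma != 0 by rewrite sqrtr_eq0 -ltNge.
have h1 := cvg_seqV (mulf_neq0 sb sg) (cvg_seqM (csqrt _ _ cv) (csqrt _ _ cw)).
have k0 : alpha / (Num.sqrt beta * Num.sqrt gamma) != 0.
  by rewrite mulf_neq0// invr_neq0// mulf_neq0.
have h := @cvg_seqZ _ _ (alpha / (Num.sqrt beta * Num.sqrt gamma))^-1 _ (cvg_seqM cf h1).
rewrite mulVf// in h; apply: cvg_near_eq h; near=> n.
have [p0 m0 n0] : [/\ 0 < phi n, 0 < mu n & 0 < nu n] by near: n.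
rewrite !(mulrC _ (_ n)^-1) !sqrtrM ?invr_ge0 ?(ltW m0) ?(ltW n0)// !sqrtrV ?(ltW m0) ?(ltW n0)//.
have sm : Num.sqrt (mu n) != 0 by rewrite sqrtr_eq0 -ltNge.
have sn : Num.sqrt (nu n) != 0 by rewrite sqrtr_eq0 -ltNge.
move: (Num.sqrt (mu n)) (Num.sqrt (nu n)) sm sn => x y x0 y0.
move: (Num.sqrt beta) (Num.sqrt gamma) sb sg => sb sg sb0 sg0.
rewrite !invfM !invrK.
move: (Num.sqrt (v n))^-1 (Num.sqrt (w n))^-1 => sv sw.
by field; rewrite a0 gt_eqF.
Unshelve. all: by end_near. Qed.

Lemma sqrt_powR (x p : R) : Num.sqrt (x `^ p) = x `^ (p / 2).
Proof. by rewrite -powR12_sqrt ?powR_ge0// -powRrM. Qed.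

End Assembly.

Section Main.
Context {R : realType} (a b s : R) (d : measure_display) (T : measurableType d).
Variables (P : probability T R) (X : nat -> {RV P >-> R}).

Lemma correlation_erwsE (n : nat) : 0 < b -> is_erws a b s X -> (0 < n)%N ->
  correlation P (position X n) (moves X n) =
  (2 * s - 1) * cov_moves a b n /
  (Num.sqrt (walkE a b s n.-1 (fun h => seq_position h ^+ 2) -
     (2 * s - 1) ^+ 2 * rising a n ^+ 2) * Num.sqrt (cov_moves b b n)).
Proof.
case: n => [|n]; first by move=> _ _.
move=> b0 [U [xi [[PX1 PX1N] PU Pxi indep recX]]] _.
by apply: (correlation_erws PX1 PX1N PU Pxi indep recX); rewrite gt_eqF.
Qed.

Lemma cov_moves0 n : 0 < b -> (0 < n)%N -> cov_moves 0 b n = 0.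
Proof.
move=> b0 n0; have e : rising 0 n = 1 :> R.
  by rewrite /rising big1// => k _; rewrite mul0r addr0.
by rewrite /cov_moves e add0r divff ?gt_eqF// mul0r; ring.
Qed.

End Main.

Section Rates.
Context {R : realType} (a b s : R).
Hypotheses (b01 : 0 < b < 1) (ba : - b <= a).

(** What the three regimes share: only the order [mu] of the variance of the
    position and its constant [beta] differ. *)
Lemma asymptotic_correlation (rho v mu psi : nat -> R) (beta C : R) :
  s != 1 / 2 -> (a + b) * Beta (a + 1) b != 1 -> 0 < beta ->
  (\forall n \near \oo, 0 < mu n) ->
  v n / mu n @[n --> \oo] --> beta ->
  (forall n, (0 < n)%N -> rho n = (2 * s - 1) * cov_moves a b n /
    (Num.sqrt (v n) * Num.sqrt (cov_moves b b n))) ->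
  C = ((a + b) * Beta (a + 1) b - 1) / (Gamma (a + 1) * Num.sqrt (b * Beta b b - 1) *
       Num.sqrt beta) ->
  (\forall n \near \oo, psi n = n%:R `^ a / Num.sqrt (mu n)) ->
  asymptotic rho (fun n => (2 * s - 1) * C * psi n).
Proof.
move=> s12.
have t0 : 2 * s - 1 != 0 by apply: contra_neq s12 => e; lra.
move=> L1 beta0 mu0 cv rhoE CE psiE.
have /andP[b0 b1] := b01.
have a1 : -1 < a by move: ba; lra.
have b1' : -1 < b by lra.
have ab0 : 0 <= a + b by move: ba; lra.
have bb0 : 0 <= b + b by lra.
have Ga : 0 < Gamma (a + 1) by apply: Gamma_gt0; lra.
have Gb : 0 < Gamma (b + 1) by apply: Gamma_gt0; lra.
have hb : 0 < b * Beta b b - 1 by rewrite subr_gt0; exact: aBeta_gt1.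
have cf := cvg_cov_moves b0 a1 ab0.
have cw := cvg_cov_moves b0 b1' bb0; rewrite -(Beta_recl b0 b0) in cw.
have alpha0 : ((a + b) * Beta (a + 1) b - 1) / (Gamma (a + 1) * Gamma (b + 1)) != 0.
  apply: mulf_neq0; first by rewrite subr_eq0.
  exact: invr_neq0 (lt0r_neq0 (mulr_gt0 Ga Gb)).
have gamma0 := divr_gt0 hb (mulr_gt0 Gb Gb).
have pos : \forall n \near \oo,
    [/\ 0 < n%:R `^ (a + b) :> R, 0 < mu n & 0 < n%:R `^ (b + b) :> R].
  near=> n; have n0 : 0 < n%:R :> R by near: n; exact: nbhs_infty_gtr.
  by split; rewrite ?powR_gt0//; near: n.
have h := asymptotic_quotient alpha0 beta0 gamma0 pos cf cv cw.
rewrite /asymptotic; apply: cvg_near_eq h; near=> n.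
have n0 : 0 < n%:R :> R by near: n; exact: nbhs_infty_gtr.
have n0' : (0 < n)%N by rewrite -(ltr0n R).
have mun : 0 < mu n by near: n.
rewrite rhoE// (_ : psi n = n%:R `^ a / Num.sqrt (mu n)); last by near: n.
have cancel (t x y : R) : t != 0 -> x / y = (t * x) / (t * y).
  by move=> tn0; rewrite -mulf_div divff// mul1r.
rewrite (cancel _ _ _ t0) -(mulrA _ (cov_moves a b n)) -(mulrA _ C).
congr (_ / (_ * _)).
rewrite CE -expr2 sqrtrM ?(ltW hb)// sqrtrV ?sqr_ge0// sqrtr_sqr gtr0_norm//.
rewrite sqrt_powR (_ : (b + b) / 2 = b); last by field.
rewrite powRD; last by rewrite (gt_eqF n0) implybT.
have sb : Num.sqrt beta != 0 by rewrite sqrtr_eq0 -ltNge.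
have sh : Num.sqrt (b * Beta b b - 1) != 0 by rewrite sqrtr_eq0 -ltNge.
have sm : Num.sqrt (mu n) != 0 by rewrite sqrtr_eq0 -ltNge.
have p0 : n%:R `^ b != 0 by rewrite gt_eqF// powR_gt0.
move: (Num.sqrt beta) (Num.sqrt (b * _ - 1)) (Num.sqrt (mu n)) sb sh sm => x y z x0 y0 z0.
move: (_ - 1) (n%:R `^ b) p0 (n%:R `^ a) => u p p0 q.
move: (Gamma _) (Gamma _) Ga Gb => g1 g2 Ga Gb.
by field; rewrite x0 y0 z0 p0 !gt_eqF.
Unshelve. all: by end_near. Qed.

End Rates.

Lemma mulr_divV (R : fieldType) (x u k : R) : x * u / k = u / (k * x^-1).
Proof. by rewrite invfM invrK -mulrA mulrC -mulrA. Qed.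

Theorem theorem2p2 (R : realType) (a b s : R)
    (hb : 0 < b < 1) (ha : - b <= a <= b) (hs : 0 <= s <= 1) :
  (forall (d : measure_display) (T : measurableType d) (P : probability T R)
     (X : nat -> {RV P >-> R}), is_erws a b s X ->
     (a = 0 \/ s = 1 / 2 ->
        forall n : nat, (1 <= n)%N ->
          correlation P (position X n) (moves X n) = 0) /\
     (a <> 0 -> s <> 1 / 2 ->
        [/\ a < b / 2 ->
              asymptotic (fun n => correlation P (position X n) (moves X n))
                (fun n => (2 * s - 1) * Pconst a b *
                          n%:R `^ (- ((b - 2 * a) / 2))),
            a = b / 2 ->
              asymptotic (fun n => correlation P (position X n) (moves X n))
                (fun n => (2 * s - 1) * Qconst a * ln n%:R `^ (- (1 / 2))) &
            b / 2 < a ->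
              asymptotic (fun n => correlation P (position X n) (moves X n))
                (fun n => (2 * s - 1) * Rconst a b s)])) /\
  [/\ 0 < a < b / 2 -> 0 < Pconst a b,
      a < 0 -> Pconst a b < 0,
      a = b / 2 -> 0 < Qconst a &
      b / 2 < a -> 0 < Rconst a b s].
Proof.
have /andP[b0 b1] := hb; have /andP[ba ab] := ha; have /andP[s0 s1] := hs.
split; last first.
  split=> [a_sub|a_neg|a_crit|a_super].
  - exact: Pconst_gt0.
  - exact: Pconst_lt0.
  - apply: Qconst_gt0; lra.
  - by apply: Rconst_gt0 => //; rewrite a_super ab.
move=> d T P X erwsX; split.
  move=> degen n n0; rewrite (correlation_erwsE b0 erwsX n0).
  case: degen => [->|->]; first by rewrite cov_moves0// mulr0 mul0r.
  by rewrite mul1r divff ?subrr ?mul0r.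
move=> a0 s12; have {}s12 : s != 1 / 2 by apply/eqP.
(* The leading coefficient of the covariance does not vanish, so the quotient of
   the correlation by its equivalent is meaningful. *)
have L1 : (a + b) * Beta (a + 1) b != 1.
  have [a_neg|a_pos] := ltP a 0.
    by rewrite lt_eqF//; apply: Beta_product_lt1 => //; lra.
  by rewrite gt_eqF//; apply: Beta_product_gt1 => //; lra.
have corE n (n0 : (0 < n)%N) := correlation_erwsE b0 erwsX n0.
split=> [a_sub|a_crit|a_super].
- have beta0 : 0 < (b - 2 * a) * Gamma b by apply: mulr_gt0; [lra|exact: Gamma_gt0].
  apply: (@asymptotic_correlation R a b s hb ba _
    (fun n => square_moment a b n - (2 * s - 1) ^+ 2 * rising a n ^+ 2)
    (fun n => n%:R `^ b) _ ((b - 2 * a) * Gamma b)^-1) => //.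
  + by rewrite invr_gt0.
  + near=> n; apply: powR_gt0; near: n; exact: nbhs_infty_gtr.
  + exact: cvg_variance_sub.
  + move=> n n0; rewrite corE// walkE_position2 ?prednK//.
    by apply/eqP => e; lra.
  + rewrite /Pconst sqrtrV ?(ltW beta0)//; exact: mulr_divV.
  + near=> n.
    have n0 : 0 < n%:R :> R by near: n; exact: nbhs_infty_gtr.
    rewrite sqrt_powR -powRB ?(gt_eqF n0) ?implybT//; congr (_ `^ _); lra.
- have a0' : 0 < a by lra.
  have Gb : 0 < Gamma (2 * a) by apply: Gamma_gt0; lra.
  have b2a : b = 2 * a by lra.
  apply: (@asymptotic_correlation R a b s hb ba _
    (fun n => critical_moment b n - (2 * s - 1) ^+ 2 * rising (b / 2) n ^+ 2)
    (fun n => n%:R `^ b * ln n%:R) _ (Gamma b)^-1) => //.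
  + by rewrite invr_gt0 b2a.
  + near=> n; apply: mulr_gt0; last by near: n; exact: ln_nat_gt0.
    by apply: powR_gt0; near: n; exact: nbhs_infty_gtr.
  + exact: cvg_variance_critical.
  + by move=> n n0; rewrite corE// walkE_position2_critical// -a_crit prednK.
  + rewrite /Qconst -(Beta_recl a0' b0) b2a sqrtrV ?(ltW Gb)//.
    exact: mulr_divV.
  + near=> n.
    have n0 : 0 < n%:R :> R by near: n; exact: nbhs_infty_gtr.
    have l0 : 0 < ln n%:R :> R by near: n; exact: ln_nat_gt0.
    rewrite sqrtrM ?powR_ge0// sqrt_powR -a_crit invfM mulrA divff ?mul1r.
      by rewrite powRN ?mul1r powR12_sqrt ?ltW.
    by rewrite gt_eqF// powR_gt0.
- have a0' : 0 < a by lra.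
  have beta0 := variance_const_gt0 hb hs (introT andP (conj a_super ab)).
  have d0 : 0 < 2 * a - b by lra.
  have Ga : 0 < Gamma (a + 1) by apply: Gamma_gt0; lra.
  have Gd : 0 < (2 * a - b) * Gamma (a + 1) ^+ 2 by rewrite mulr_gt0// exprn_gt0.
  suff h : asymptotic (fun n => correlation P (position X n) (moves X n))
      (fun n => (2 * s - 1) * Rconst a b s * 1).
    by move: h; rewrite /asymptotic mulr1.
  apply: (@asymptotic_correlation R a b s hb ba _
    (fun n => square_moment a b n - (2 * s - 1) ^+ 2 * rising a n ^+ 2)
    (fun n => n%:R `^ (2 * a)) (fun=> 1)
    ((a ^+ 2 * Beta a a - (2 * s - 1) ^+ 2 * (2 * a - b)) /
    ((2 * a - b) * Gamma (a + 1) ^+ 2))) => //.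
  + exact: divr_gt0.
  + near=> n; apply: powR_gt0; near: n; exact: nbhs_infty_gtr.
  + exact: cvg_variance_super.
  + move=> n n0; rewrite corE// walkE_position2 ?prednK//.
    by apply/eqP => e; lra.
  + have vb : 0 < b * Beta b b - 1 by rewrite subr_gt0; exact: aBeta_gt1.
    rewrite /Rconst -(Beta_recl a0' b0) !sqrtrM ?(ltW beta0) ?(ltW d0)//.
    rewrite sqrtrV ?(ltW Gd)// sqrtrM ?(ltW d0)// sqrtr_sqr gtr0_norm//.
    have x0 : Num.sqrt (2 * a - b) != 0 by rewrite sqrtr_eq0 -ltNge.
    have y0 : Num.sqrt (b * Beta b b - 1) != 0 by rewrite sqrtr_eq0 -ltNge.
    have z0 : Num.sqrt (a ^+ 2 * Beta a a - (2 * s - 1) ^+ 2 * (2 * a - b)) != 0.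
      by rewrite sqrtr_eq0 -ltNge.
    move: (Num.sqrt _) (Num.sqrt _) (Num.sqrt _) x0 z0 y0 => x z y x0 z0 y0.
    move: (Gamma _) Ga (_ - 1) => g g0 u; clear -x0 y0 z0 g0.
    by field; rewrite x0 y0 z0 gt_eqF.
  + near=> n.
    have n0 : 0 < n%:R :> R by near: n; exact: nbhs_infty_gtr.
    rewrite sqrt_powR (_ : 2 * a / 2 = a); last by field.
    by rewrite divff// gt_eqF// powR_gt0.
Unshelve. all: by end_near. Qed.
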